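(* Let $B$ be a Blaschke product with zero set $\Lambda$. Let $H\in\mathrm{Har}_+(\mathbb{D})$ be such that $$\inf\{e^{H(z)}:z\in Q\}\geq N(Q)$$ for any dyadic Whitney square $Q$. Assume that the function $-\log|B|$ has a harmonic majorant on the set $\{z\in\mathbb{D}:\rho(z,\Lambda)\geq e^{-H(z)}\}$. Then, for any $C>1$, the function $-\log|B|$ has a harmonic majorant on the set $\{z\in\mathbb{D}:\rho(z,\Lambda)\geq e^{-CH(z)}\}$.
   Context: $\mathbb{D}$ is the open unit disc of $\mathbb{C}$. $\mathrm{Har}_+(\mathbb{D})$ is the cone of positive harmonic functions in $\mathbb{D}$. The pseudohyperbolic distance is $\rho(a_1,a_2)=\left|\frac{a_1-a_2}{1-\overline{a_2}a_1}\right|$, and $\rho(z,\Lambda)=\inf_{\lambda\in\Lambda}\rho(z,\lambda)$. A function $F$ with values in $[0,+\infty)$ has a harmonic majorant on a set $E\subset\mathbb{D}$ if there exists $H_1\in\mathrm{Har}_+(\mathbb{D})$ such that $F(z)\leq H_1(z)$ for all $z\in E$ (only the values of $F$ on $E$ matter). The dyadic Whitney squares are $$Q_{k,j}=\{re^{i\theta}\in\mathbb{D}:2^{-k}\leq 1-r<2^{-k+1},\ j2\pi2^{-k}\leq\theta<(j+1)2\pi2^{-k}\},\quad k\geq0,\ j=0,\ldots,2^k-1.$$ For a dyadic Whitney square $Q$, $N(Q)=\#(\Lambda\cap Q)$ is the number of points of the sequence $\Lambda$ (zeros counted with multiplicity) in $Q$. *)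

(* Defs.v *)
(* Stdlib reals with Coquelicot; [C] is Coquelicot's [R * R]. *)
From Stdlib Require Import Reals List.
From Coquelicot Require Import Coquelicot.
Open Scope R_scope.

Definition disc (z : C) : Prop := Cmod z < 1.

(* [H] is a total function, but only its restriction to the disc matters: the
   disc is open, so the partial derivatives below depend on nothing else.
   [ex_diff_n _ 2] at every point of the disc is the C^2 condition. *)
Definition harmonic_disc (H : C -> R) : Prop :=
  forall x y : R, disc (x, y) ->
    ex_diff_n (fun u v => H (u, v)) 2 x y /\
    partial_derive 2 0 (fun u v => H (u, v)) x y
      + partial_derive 0 2 (fun u v => H (u, v)) x y = 0.

Definition Har_plus (H : C -> R) : Prop :=
  harmonic_disc H /\ forall z : C, disc z -> 0 < H z.

Definition has_harmonic_majorant (F : C -> R) (E : C -> Prop) : Prop :=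
  exists H1 : C -> R, Har_plus H1 /\ forall z : C, E z -> F z <= H1 z.

(* A finite or infinite sequence of points with repetitions: indices [n] with
   [L n = None] carry no point, and a zero of multiplicity m is listed at m
   different indices. *)
Definition zero_seq : Type := nat -> option C.

Definition rho (a1 a2 : C) : R :=
  Cmod ((a1 - a2) / (1 - Cconj a2 * a1))%C.

(* Valued in [Rbar]: for the empty sequence the infimum is [p_infty]. *)
Definition rho_seq (z : C) (L : zero_seq) : Rbar :=
  Glb_Rbar (fun r => exists (n : nat) (a : C), L n = Some a /\ r = rho z a).

Definition blaschke_factor (a z : C) : C :=
  if Ceq_dec a 0 then z
  else (RtoC (Cmod a) / a * ((a - z) / (1 - Cconj a * z)))%C.

Fixpoint blaschke_partial (L : zero_seq) (n : nat) (z : C) : C :=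
  match n with
  | O => 1%C
  | S m =>
      (blaschke_partial L m z *
       match L m with Some a => blaschke_factor a z | None => 1%C end)%C
  end.

(* Blaschke products are taken up to a unimodular constant factor. *)
Definition is_blaschke_product (L : zero_seq) (B : C -> C) : Prop :=
  (forall (n : nat) (a : C), L n = Some a -> disc a) /\
  ex_series (fun n => match L n with Some a => 1 - Cmod a | None => 0 end) /\
  exists c : C, Cmod c = 1 /\
    forall z : C, disc z ->
      filterlim (fun n => (c * blaschke_partial L n z)%C) eventually
        (locally (B z)).

Definition whitney (k j : nat) (z : C) : Prop :=
  exists r theta : R,
    0 <= r < 1 /\
    z = (r * cos theta, r * sin theta) /\
    / 2 ^ k <= 1 - r < 2 / 2 ^ k /\
    INR j * (2 * PI) / 2 ^ k <= theta < (INR j + 1) * (2 * PI) / 2 ^ k.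

(* The number of indices [n] with [L n] in [Q], as an element of [0, +oo]: the
   supremum of the lengths of the duplicate-free lists of such indices. *)
Definition count_in (L : zero_seq) (Q : C -> Prop) : Rbar :=
  Lub_Rbar (fun r => exists l : list nat,
    NoDup l /\
    (forall n, In n l -> exists a : C, L n = Some a /\ Q a) /\
    r = INR (length l)).

Definition inf_on (Q : C -> Prop) (f : C -> R) : Rbar :=
  Glb_Rbar (fun r => exists z : C, Q z /\ r = f z).

(* Such a set contains no zero of the corresponding Blaschke product, so the
   convention [ln 0 = 0] is never used in the majorization of [neg_log_mod]. *)
Definition far_from (L : zero_seq) (t : C -> R) (z : C) : Prop :=
  disc z /\ Rbar_le (exp (- t z)) (rho_seq z L).

Definition neg_log_mod (B : C -> C) (z : C) : R := - ln (Cmod (B z)).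

(* Main.v *)
(* If [H z] is bounded by a constant then [rho z Lambda] is bounded below, and there
   [- log |B|] is at most a multiple of the Poisson integral of the Blaschke sums
   [1 - |a|] placed at the points [a / |a|]. If [H z] is large, the bound on the
   number of zeros in the Whitney square of [z] leaves room for a point [z'] with
   [rho z' Lambda >= e^{- H z'}] at pseudohyperbolic distance [O(e^{- H z / 4})]
   from [z]; this is so close that for every zero [a] the value [log (1 / rho z a)] is
   at most [8 c log (1 / rho z' a)] up to the same Poisson term. Summing over the
   zeros bounds [- log |B z|] by [- log |B z'|], that is by the given majorant at
   [z'], which Harnack's inequality compares with its value at [z]. *)
Require Import Defs.
From Stdlib Require Import Reals Lra Lia Psatz List Classical.
From Coquelicot Require Import Coquelicot.
Open Scope R_scope.

(** * Harnack's inequality *)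

(** One Whitney square may hold up to [e^{H z}] zeros, so a bound obtained by counting the zeros
    near [z] would not be uniform. The comparison is therefore made zero by zero, and the counting
    hypothesis serves to find [z']. The exponents arise as follows. Harnack's inequality gives
    [H z' >= 3/4 H z] for all candidates [z'], so a zero excludes at most a pseudohyperbolic disc of
    radius [e^{-3 H z / 4}]. More than [e^{H z}] candidates in a square grid means about
    [e^{H z / 2}] per side; with spacing comparable to [e^{-3 H z / 4}] the grid has side of order
    [e^{-H z / 4}]. Halving this exponent absorbs all numerical constants: a zero closer to [z] than
    the grid size has [log (1 / rho z' a) >= H z / 8], while [log (1 / rho z a) <= c H z], and the
    quotient is [8 c]. Positive harmonic functions are known here only through their partial
    derivatives. Harnack's inequality is therefore drawn from a gradient bound, in which integrals
    over circles of the holomorphic function [H_x - i H_y] replace a Poisson representation of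
    [H]. *)

Definition C1_at (f f1 f2 : R -> R -> R) (u v : R) : Prop :=
  is_derive (fun z => f z v) u (f1 u v) /\
  is_derive (fun z => f u z) v (f2 u v) /\
  continuity_2d_pt f1 u v /\ continuity_2d_pt f2 u v.

Definition unit_disc (u v : R) : Prop := u * u + v * v < 1.

Lemma disc_unit_disc (x y : R) : Defs.disc (x, y) <-> unit_disc x y.
Proof.
unfold Defs.disc, unit_disc, Cmod; simpl.
replace (x * (x * 1) + y * (y * 1)) with (x * x + y * y) by ring.
split; intros h.
- apply sqrt_lt_0_alt; rewrite sqrt_1; exact h.
- rewrite <- sqrt_1; apply sqrt_lt_1_alt; nra.
Qed.

Lemma unit_disc_open (x y : R) :
  unit_disc x y -> locally_2d unit_disc x y.
Proof.
intros h.
assert (c : continuity_2d_pt (fun u v => u * u + v * v) x y).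
{ apply continuity_2d_pt_plus; apply continuity_2d_pt_mult;
  first [apply continuity_2d_pt_id1 | apply continuity_2d_pt_id2]. }
unfold unit_disc in *.
assert (e : 0 < 1 - (x * x + y * y)) by lra.
destruct (c (mkposreal _ e)) as [d hd].
exists d; intros u v hu hv.
specialize (hd u v hu hv); simpl in hd; apply Rabs_def2 in hd; lra.
Qed.

Lemma C1_differentiable (f f1 f2 : R -> R -> R) (x y : R) :
  locally_2d (C1_at f f1 f2) x y ->
  differentiable_pt_lim f x y (f1 x y) (f2 x y).
Proof.
intros h.
apply filterdiff_differentiable_pt_lim.
destruct (locally_2d_singleton _ _ _ h) as [_ [h2 [c1 _]]].
apply (is_derive_filterdiff f x y f1 (f2 x y)).
- apply locally_2d_locally in h; revert h.
  apply filter_imp; intros [u v] [h1 _]; exact h1.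
- exact h2.
- apply continuity_2d_pt_filterlim; exact c1.
Qed.

Lemma C1_continuity (f f1 f2 : R -> R -> R) (x y : R) :
  locally_2d (C1_at f f1 f2) x y -> continuity_2d_pt f x y.
Proof.
intros h; apply differentiable_continuity_pt.
exists (f1 x y), (f2 x y); exact (C1_differentiable _ _ _ _ _ h).
Qed.

Lemma C1_comp (f f1 f2 : R -> R -> R) (g h : R -> R) (t dg dh : R) :
  locally_2d (C1_at f f1 f2) (g t) (h t) ->
  is_derive g t dg -> is_derive h t dh ->
  is_derive (fun s => f (g s) (h s)) t (f1 (g t) (h t) * dg + f2 (g t) (h t) * dh).
Proof.
intros c hg hh; apply is_derive_Reals.
apply derivable_pt_lim_comp_2d.
- now apply C1_differentiable.
- now apply is_derive_Reals.
- now apply is_derive_Reals.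
Qed.

Lemma continuity_2d_comp (f g h : R -> R -> R) (x y : R) :
  continuity_2d_pt f (g x y) (h x y) ->
  continuity_2d_pt g x y -> continuity_2d_pt h x y ->
  continuity_2d_pt (fun u v => f (g u v) (h u v)) x y.
Proof.
intros cf cg ch eps.
destruct (cf eps) as [d hd].
destruct (cg d) as [d1 h1]; destruct (ch d) as [d2 h2].
assert (p : 0 < Rmin d1 d2) by (apply Rmin_pos; apply cond_pos).
exists (mkposreal _ p); simpl; intros u v hu hv.
pose proof (Rmin_l d1 d2); pose proof (Rmin_r d1 d2).
apply hd; [apply h1 | apply h2]; lra.
Qed.

Lemma continuity_2d_slice (f : R -> R -> R) (x y : R) :
  continuity_2d_pt f x y -> continuous (fun t => f x t) y.
Proof.
intros c; apply continuity_pt_filterlim.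
intros e he; destruct (c (mkposreal e he)) as [d hd].
exists d; split; [apply cond_pos |].
intros t [_ ht]; simpl in *; unfold Rdist in *.
apply hd; [| exact ht].
rewrite Rminus_diag, Rabs_R0; apply cond_pos.
Qed.

Lemma continuity_2d_pt_snd (g : R -> R) (x y : R) :
  continuity_pt g y -> continuity_2d_pt (fun _ v => g v) x y.
Proof.
intros c; apply (continuity_1d_2d_pt_comp g (fun _ v => v)); [exact c |].
apply continuity_2d_pt_id2.
Qed.

(** The strip is symmetric about 0 because [s] will be the radius of a circle: radius 0, where the
    integrals are explicit, has to be an interior point of the parameter range. *)
Lemma is_derive_RInt_strip (g dg : R -> R -> R) (a b R0 r : R) :
  (forall s t, Rabs s < R0 -> is_derive (fun z => g z t) s (dg s t)) ->
  (forall s t, Rabs s < R0 -> continuity_2d_pt dg s t) ->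
  (forall s t, Rabs s < R0 -> continuity_2d_pt g s t) ->
  Rabs r < R0 ->
  is_derive (fun s => RInt (g s) a b) r (RInt (dg r) a b).
Proof.
intros hd cd cg hr.
assert (lr : locally r (fun s => Rabs s < R0)).
{ assert (e : 0 < R0 - Rabs r) by lra.
  exists (mkposreal _ e); intros s hs.
  change (Rabs (s - r) < R0 - Rabs r) in hs.
  pose proof (Rabs_triang_inv s r); lra. }
replace (RInt (dg r) a b) with (RInt (fun t => Derive (fun u => g u t) r) a b).
2:{ apply RInt_ext; intros t _; apply is_derive_unique; auto. }
apply is_derive_RInt_param.
- revert lr; apply filter_imp; intros s hs t _; exists (dg s t); auto.
- intros t _.
  apply (continuity_2d_pt_ext_loc dg); [| auto].
  apply locally_2d_locally.
  assert (l2 : locally_2d (fun u v => Rabs u < R0) r t).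
  { destruct lr as [d hd']; exists d; intros u v hu _; apply hd'; exact hu. }
  apply locally_2d_locally in l2; revert l2; apply filter_imp.
  intros [u v] hu; simpl in *; symmetry; apply is_derive_unique; auto.
- revert lr; apply filter_imp; intros s hs.
  apply (ex_RInt_continuous (V := R_CompleteNormedModule)).
  intros t _; apply continuity_2d_slice; auto.
Qed.

(** * Integrals over circles and the gradient bound *)

Definition in_region (D : R -> R -> Prop) (x0 y0 R0 : R) : Prop :=
  forall u v, (u - x0) ^ 2 + (v - y0) ^ 2 < R0 ^ 2 -> D u v.

Lemma circle_in (D : R -> R -> Prop) (x0 y0 R0 r t : R) :
  in_region D x0 y0 R0 -> Rabs r < R0 ->
  D (x0 + r * cos t) (y0 + r * sin t).
Proof.
intros h hr; apply h.
pose proof (sin2_cos2 t) as e; unfold Rsqr in e.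
assert (h2 : r ^ 2 < R0 ^ 2).
{ apply Rabs_def2 in hr; nra. }
nra.
Qed.

Lemma is_derive_circle_r (f f1 f2 : R -> R -> R) (x0 y0 r t : R) :
  locally_2d (C1_at f f1 f2) (x0 + r * cos t) (y0 + r * sin t) ->
  is_derive (fun s => f (x0 + s * cos t) (y0 + s * sin t)) r
    (f1 (x0 + r * cos t) (y0 + r * sin t) * cos t +
     f2 (x0 + r * cos t) (y0 + r * sin t) * sin t).
Proof.
intros h.
apply (C1_comp f f1 f2 (fun s => x0 + s * cos t) (fun s => y0 + s * sin t)).
- exact h.
- auto_derive; [trivial | ring].
- auto_derive; [trivial | ring].
Qed.

Lemma is_derive_circle_t (f f1 f2 : R -> R -> R) (x0 y0 r t : R) :
  locally_2d (C1_at f f1 f2) (x0 + r * cos t) (y0 + r * sin t) ->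
  is_derive (fun s => f (x0 + r * cos s) (y0 + r * sin s)) t
    (f1 (x0 + r * cos t) (y0 + r * sin t) * (- r * sin t) +
     f2 (x0 + r * cos t) (y0 + r * sin t) * (r * cos t)).
Proof.
intros h.
apply (C1_comp f f1 f2 (fun s => x0 + r * cos s) (fun s => y0 + r * sin s)).
- exact h.
- auto_derive; [trivial | ring].
- auto_derive; [trivial | ring].
Qed.

Lemma continuity_2d_circle (f : R -> R -> R) (x0 y0 r t : R) :
  continuity_2d_pt f (x0 + r * cos t) (y0 + r * sin t) ->
  continuity_2d_pt (fun s a => f (x0 + s * cos a) (y0 + s * sin a)) r t.
Proof.
intros h.
apply (continuity_2d_comp f (fun s a => x0 + s * cos a)
         (fun s a => y0 + s * sin a)); [exact h | |];
  apply continuity_2d_pt_plus; try apply continuity_2d_pt_const;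
  apply continuity_2d_pt_mult; try apply continuity_2d_pt_id1;
  apply continuity_2d_pt_snd.
- apply continuity_cos.
- apply continuity_sin.
Qed.

Lemma C1_opp (f f1 f2 : R -> R -> R) (x y : R) :
  C1_at f f1 f2 x y ->
  C1_at (fun u v => - f u v) (fun u v => - f1 u v) (fun u v => - f2 u v) x y.
Proof.
intros [h1 [h2 [h3 h4]]]; split; [| split; [| split]].
- apply (is_derive_opp (V := R_NormedModule)); exact h1.
- apply (is_derive_opp (V := R_NormedModule)); exact h2.
- now apply continuity_2d_pt_opp.
- now apply continuity_2d_pt_opp.
Qed.

Lemma locally_2d_C1 (f f1 f2 : R -> R -> R) (D : R -> R -> Prop) :
  (forall u v, D u v -> locally_2d D u v) ->
  (forall u v, D u v -> C1_at f f1 f2 u v) ->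
  forall u v, D u v -> locally_2d (C1_at f f1 f2) u v.
Proof.
intros o h u v d; destruct (o u v d) as [e he].
exists e; intros a b ha hb; apply h; apply he; assumption.
Qed.

Lemma continuity_pt_cos_mul (k t : R) : continuity_pt (fun s => cos (k * s)) t.
Proof.
apply derivable_continuous_pt; exists (- k * sin (k * t)).
apply is_derive_Reals; auto_derive; [trivial | ring].
Qed.

Lemma continuity_pt_sin_mul (k t : R) : continuity_pt (fun s => sin (k * s)) t.
Proof.
apply derivable_continuous_pt; exists (k * cos (k * t)).
apply is_derive_Reals; auto_derive; [trivial | ring].
Qed.

Lemma is_RInt_continuous (f : R -> R) (a b : R) :
  (forall t, continuous f t) -> is_RInt f a b (RInt f a b).
Proof.
intros h; apply (RInt_correct (V := R_CompleteNormedModule)).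
apply (ex_RInt_continuous (V := R_CompleteNormedModule)); auto.
Qed.

(* Cauchy's theorem for the moments of the holomorphic function [p - i q]: the
   real part of [r ^ k] times the integral of [(p - i q) e^{i k t}] does not
   depend on [r]. *)
Lemma circle_moment (p p1 p2 q q1 q2 : R -> R -> R) (D : R -> R -> Prop)
    (x0 y0 R0 r : R) (k : nat) :
  (forall u v, D u v -> locally_2d D u v) ->
  (forall u v, D u v -> C1_at p p1 p2 u v) ->
  (forall u v, D u v -> C1_at q q1 q2 u v) ->
  (forall u v, D u v -> p1 u v + q2 u v = 0 /\ p2 u v = q1 u v) ->
  in_region D x0 y0 R0 -> 0 < r < R0 ->
  is_RInt (fun t => p (x0 + r * cos t) (y0 + r * sin t) * cos (INR k * t) +
                    q (x0 + r * cos t) (y0 + r * sin t) * sin (INR k * t))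
    0 (2 * PI)
    match k with O => 2 * PI * p x0 y0 | S _ => 0 end.
Proof.
intros oD hp hq cr hin hr.
pose (g := fun r t =>
  p (x0 + r * cos t) (y0 + r * sin t) * cos (INR k * t) +
  q (x0 + r * cos t) (y0 + r * sin t) * sin (INR k * t)).
pose (dg := fun r t =>
  (p1 (x0 + r * cos t) (y0 + r * sin t) * cos t +
   p2 (x0 + r * cos t) (y0 + r * sin t) * sin t) * cos (INR k * t) +
  (q1 (x0 + r * cos t) (y0 + r * sin t) * cos t +
   q2 (x0 + r * cos t) (y0 + r * sin t) * sin t) * sin (INR k * t)).
assert (Lp := locally_2d_C1 _ _ _ _ oD hp).
assert (Lq := locally_2d_C1 _ _ _ _ oD hq).
assert (cP : forall s t, Rabs s < R0 -> continuity_2d_pt g s t).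
{ intros s t hs; assert (d := circle_in D x0 y0 R0 s t hin hs).
  unfold g; apply continuity_2d_pt_plus; apply continuity_2d_pt_mult;
    try (apply continuity_2d_circle; eapply C1_continuity; eauto).
  - apply continuity_2d_pt_snd; apply continuity_pt_cos_mul.
  - apply continuity_2d_pt_snd; apply continuity_pt_sin_mul. }
assert (cdP : forall s t, Rabs s < R0 -> continuity_2d_pt dg s t).
{ intros s t hs; assert (d := circle_in D x0 y0 R0 s t hin hs).
  destruct (hp _ _ d) as [_ [_ [c1 c2]]]; destruct (hq _ _ d) as [_ [_ [c3 c4]]].
  unfold dg; repeat first [apply continuity_2d_pt_plus | apply continuity_2d_pt_mult];
    try (apply continuity_2d_circle; assumption);
    apply continuity_2d_pt_snd;
    solve [apply continuity_pt_cos_mul | apply continuity_pt_sin_mul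
          | apply continuity_cos | apply continuity_sin]. }
assert (dP : forall s t, Rabs s < R0 -> is_derive (fun z => g z t) s (dg s t)).
{ intros s t hs; assert (d := circle_in D x0 y0 R0 s t hin hs).
  assert (e1 := is_derive_circle_r p p1 p2 x0 y0 s t (Lp _ _ d)).
  assert (e2 := is_derive_circle_r q q1 q2 x0 y0 s t (Lq _ _ d)).
  unfold g, dg.
  apply (is_derive_plus (V := R_NormedModule)).
  - apply (is_derive_scal_l (V := R_NormedModule)); exact e1.
  - apply (is_derive_scal_l (V := R_NormedModule)); exact e2. }
assert (dA : forall s, Rabs s < R0 ->
  is_derive (fun s => RInt (g s) 0 (2 * PI)) s (RInt (dg s) 0 (2 * PI))).
{ intros s hs; apply (is_derive_RInt_strip g dg 0 (2 * PI) R0); auto. }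
assert (kper : cos (INR k * (2 * PI)) = 1 /\ sin (INR k * (2 * PI)) = 0).
{ split.
  - rewrite <- cos_0, <- (cos_period 0 k); f_equal; ring.
  - rewrite <- sin_0, <- (sin_period 0 k); f_equal; ring. }
assert (E : forall s, Rabs s < R0 ->
  INR k * RInt (g s) 0 (2 * PI) + s * RInt (dg s) 0 (2 * PI) = 0).
{ intros s hs.
  assert (i1 : is_RInt (g s) 0 (2 * PI) (RInt (g s) 0 (2 * PI))).
  { apply is_RInt_continuous; intros t; apply continuity_2d_slice; auto. }
  assert (i2 : is_RInt (dg s) 0 (2 * PI) (RInt (dg s) 0 (2 * PI))).
  { apply is_RInt_continuous; intros t; apply continuity_2d_slice; auto. }
  assert (i3 := is_RInt_plus (V := R_NormedModule) _ _ _ _ _ _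
    (is_RInt_scal (V := R_NormedModule) _ _ _ (INR k) _ i1)
    (is_RInt_scal (V := R_NormedModule) _ _ _ s _ i2)).
  change (is_RInt (fun t => INR k * g s t + s * dg s t) 0 (2 * PI)
    (INR k * RInt (g s) 0 (2 * PI) + s * RInt (dg s) 0 (2 * PI))) in i3.
  (* [g s] is the real part of [(p - i q) e^{i k t}] and [w] its imaginary part. By the
     Cauchy-Riemann equations the derivative of [w] in [t] is [INR k * g s t + s * dg s t], and [w]
     has period [2 PI]. *)
  pose (w := fun t => p (x0 + s * cos t) (y0 + s * sin t) * sin (INR k * t) -
                      q (x0 + s * cos t) (y0 + s * sin t) * cos (INR k * t)).
  assert (i4 : is_RInt (fun t => INR k * g s t + s * dg s t) 0 (2 * PI)
    (minus (w (2 * PI)) (w 0))).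
  { apply (is_RInt_derive (V := R_CompleteNormedModule) w).
    - intros t _; assert (d := circle_in D x0 y0 R0 s t hin hs).
      assert (e1 := is_derive_circle_t p p1 p2 x0 y0 s t (Lp _ _ d)).
      assert (e2 := is_derive_circle_t q q1 q2 x0 y0 s t (Lq _ _ d)).
      assert (e3 : is_derive (fun t => sin (INR k * t)) t (INR k * cos (INR k * t)))
        by (auto_derive; [trivial | ring]).
      assert (e4 : is_derive (fun t => cos (INR k * t)) t (- INR k * sin (INR k * t)))
        by (auto_derive; [trivial | ring]).
      assert (f1 := is_derive_mult _ _ _ _ _ e1 e3 Rmult_comm).
      assert (f2 := is_derive_mult _ _ _ _ _ e2 e4 Rmult_comm).
      assert (f3 := is_derive_minus (V := R_NormedModule) _ _ _ _ _ f1 f2).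
      destruct (cr _ _ d) as [c1 c2].
      refine (eq_ind _ (fun l => is_derive _ t l) f3 _ _).
      unfold g, dg, minus, plus, opp, mult; simpl.
      assert (c3 : q2 (x0 + s * cos t) (y0 + s * sin t) =
                   - p1 (x0 + s * cos t) (y0 + s * sin t)) by lra.
      rewrite c2, c3; ring.
    - intros t _.
      apply (continuous_plus (V := R_NormedModule)).
      + apply (continuous_scal_r (V := R_NormedModule)); apply continuity_2d_slice; auto.
      + apply (continuous_scal_r (V := R_NormedModule)); apply continuity_2d_slice; auto. }
  assert (u3 := is_RInt_unique _ _ _ _ i3); assert (u4 := is_RInt_unique _ _ _ _ i4).
  rewrite u3 in u4; rewrite u4.
  destruct kper as [kc ks].
  unfold w; rewrite kc, ks, sin_2PI, cos_2PI, sin_0, cos_0, !Rmult_0_r, ?sin_0, ?cos_0.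
  unfold minus, plus, opp; simpl; ring. }
(* By [E] the derivative of [s ^ k * RInt (g s) 0 (2 * PI)] vanishes for positive [s], so the value
   at [r] equals the value at 0. For [k = 0] the latter is the mean over a point; for [k > 0] it is
   killed by [0 ^ k]. *)
assert (J : r ^ k * RInt (g r) 0 (2 * PI) = 0 ^ k * RInt (g 0) 0 (2 * PI)).
{ destruct (MVT_gen (fun s => s ^ k * RInt (g s) 0 (2 * PI)) 0 r (fun _ => 0))
    as [c [_ hc]].
  - rewrite Rmin_left, Rmax_right by lra; intros s hs.
    assert (hs' : Rabs s < R0) by (apply Rabs_def1; lra).
    assert (m := is_derive_mult _ _ _ _ _
      (is_derive_pow _ k _ _ (is_derive_id s)) (dA s hs') Rmult_comm).
    refine (eq_ind _ (fun l => is_derive _ s l) m _ _).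
    unfold plus, mult, one; simpl.
    assert (e := E s hs').
    apply (Rmult_eq_reg_l s); [| lra].
    replace (s * (INR k * 1 * s ^ Init.Nat.pred k * RInt (g s) 0 (2 * PI) +
                  s ^ k * RInt (dg s) 0 (2 * PI)))
      with (s ^ k * (INR k * RInt (g s) 0 (2 * PI) + s * RInt (dg s) 0 (2 * PI))).
    + rewrite e; ring.
    + destruct k; simpl; ring.
  - rewrite Rmin_left, Rmax_right by lra; intros s hs.
    assert (hs' : Rabs s < R0) by (apply Rabs_def1; lra).
    apply continuity_pt_mult.
    + apply derivable_continuous_pt; apply derivable_pt_pow.
    + apply continuity_pt_filterlim.
      apply (ex_derive_continuous (V := R_NormedModule) (fun s => RInt (g s) 0 (2 * PI))).
      exists (RInt (dg s) 0 (2 * PI)); exact (dA s hs').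
  - lra. }
assert (hr' : Rabs r < R0) by (apply Rabs_def1; lra).
cut (RInt (g r) 0 (2 * PI) = match k with O => 2 * PI * p x0 y0 | S _ => 0 end).
{ intros e.
  refine (eq_ind _ (fun l => is_RInt (g r) 0 (2 * PI) l) _ _ e).
  apply is_RInt_continuous; intros t; apply continuity_2d_slice; auto. }
destruct k as [| k].
- simpl in J.
  rewrite !Rmult_1_l in J; rewrite J.
  rewrite (RInt_ext _ (fun _ => p x0 y0)).
  + rewrite RInt_const; unfold scal; simpl; unfold mult; simpl; ring.
  + intros t _; unfold g; simpl; rewrite !Rmult_0_l, cos_0, sin_0, !Rplus_0_r; ring.
- rewrite pow_ne_zero, Rmult_0_l in J by lia.
  apply Rmult_integral in J; destruct J as [J | J]; [| exact J].
  exfalso; apply (pow_nonzero r (S k)); [lra | exact J].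
Qed.

Lemma unit_combination_le (a b t : R) :
  a ^ 2 + b ^ 2 <= 1 -> 0 <= 1 + a * cos t + b * sin t.
Proof.
intros h; pose proof (sin2_cos2 t) as e; unfold Rsqr in e.
assert ((a * cos t + b * sin t) ^ 2 <= 1).
{ replace ((a * cos t + b * sin t) ^ 2)
    with ((a ^ 2 + b ^ 2) * (sin t * sin t + cos t * cos t) -
          (a * sin t - b * cos t) ^ 2) by ring.
  rewrite e; pose proof (pow2_ge_0 (a * sin t - b * cos t)); lra. }
nra.
Qed.

(* [1 + a cos t + b sin t >= 0], and integrating [H] against this weight over
   the circle of radius [r] gives [2 PI H + PI r (a p + b q)] at the centre. *)
Lemma gradient_bound (H p p1 p2 q q1 q2 : R -> R -> R) (D : R -> R -> Prop)
    (x0 y0 R0 r a b : R) :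
  (forall u v, D u v -> locally_2d D u v) ->
  (forall u v, D u v -> C1_at H p q u v) ->
  (forall u v, D u v -> C1_at p p1 p2 u v) ->
  (forall u v, D u v -> C1_at q q1 q2 u v) ->
  (forall u v, D u v -> p1 u v + q2 u v = 0 /\ p2 u v = q1 u v) ->
  (forall u v, D u v -> 0 <= H u v) ->
  in_region D x0 y0 R0 -> 0 < r < R0 -> a ^ 2 + b ^ 2 <= 1 ->
  - (2 / r) * H x0 y0 <= a * p x0 y0 + b * q x0 y0.
Proof.
intros oD hH hp hq cr pos hin hr hab.
assert (LH := locally_2d_C1 _ _ _ _ oD hH).
assert (Lp := locally_2d_C1 _ _ _ _ oD hp).
assert (Lq := locally_2d_C1 _ _ _ _ oD hq).
pose (w := fun t => 1 + a * cos t + b * sin t).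
assert (cw : forall t, continuity_pt w t).
{ intros t; apply derivable_continuous_pt; exists (- a * sin t + b * cos t).
  apply is_derive_Reals; unfold w; auto_derive; [trivial | ring]. }
pose (g := fun r t => H (x0 + r * cos t) (y0 + r * sin t) * w t).
pose (dg := fun r t =>
  (p (x0 + r * cos t) (y0 + r * sin t) * cos t +
   q (x0 + r * cos t) (y0 + r * sin t) * sin t) * w t).
assert (cP : forall s t, Rabs s < R0 -> continuity_2d_pt g s t).
{ intros s t hs; assert (d := circle_in D x0 y0 R0 s t hin hs).
  unfold g; apply continuity_2d_pt_mult.
  - apply continuity_2d_circle; eapply C1_continuity; eauto.
  - apply continuity_2d_pt_snd; apply cw. }
assert (cdP : forall s t, Rabs s < R0 -> continuity_2d_pt dg s t).
{ intros s t hs; assert (d := circle_in D x0 y0 R0 s t hin hs).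
  destruct (hH _ _ d) as [_ [_ [c1 c2]]].
  unfold dg; apply continuity_2d_pt_mult;
    [| apply continuity_2d_pt_snd; apply cw].
  apply continuity_2d_pt_plus; apply continuity_2d_pt_mult;
    try (apply continuity_2d_circle; assumption); apply continuity_2d_pt_snd.
  - apply continuity_cos.
  - apply continuity_sin. }
assert (dP : forall s t, Rabs s < R0 -> is_derive (fun z => g z t) s (dg s t)).
{ intros s t hs; assert (d := circle_in D x0 y0 R0 s t hin hs).
  unfold g, dg; apply (is_derive_scal_l (V := R_NormedModule)).
  exact (is_derive_circle_r H p q x0 y0 s t (LH _ _ d)). }
assert (dA : forall s, Rabs s < R0 ->
  is_derive (fun s => RInt (g s) 0 (2 * PI)) s (RInt (dg s) 0 (2 * PI))).
{ intros s hs; apply (is_derive_RInt_strip g dg 0 (2 * PI) R0); auto. }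
(* The product formulas write the integrand through moments of order 0, 1 and 2. The terms with [b]
   are moments of [i (p - i q) = q + i p], that is of the pair [(q, - p)]. Only the moments of order
   0 survive, so the derivative does not depend on [s]. *)
assert (V : forall s, 0 < s < R0 ->
  RInt (dg s) 0 (2 * PI) = PI * (a * p x0 y0 + b * q x0 y0)).
{ intros s hs.
  assert (cr' : forall u v, D u v -> q1 u v + - p2 u v = 0 /\ q2 u v = - p1 u v).
  { intros u v d; destruct (cr u v d); lra. }
  assert (hp' : forall u v, D u v ->
    C1_at (fun u v => - p u v) (fun u v => - p1 u v) (fun u v => - p2 u v) u v).
  { intros u v d; apply C1_opp; auto. }
  assert (A0 := circle_moment p p1 p2 q q1 q2 D x0 y0 R0 s 0 oD hp hq cr hin hs).
  assert (A1 := circle_moment p p1 p2 q q1 q2 D x0 y0 R0 s 1 oD hp hq cr hin hs).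
  assert (A2 := circle_moment p p1 p2 q q1 q2 D x0 y0 R0 s 2 oD hp hq cr hin hs).
  assert (B0 := circle_moment q q1 q2 _ _ _ D x0 y0 R0 s 0 oD hq hp' cr' hin hs).
  assert (B2 := circle_moment q q1 q2 _ _ _ D x0 y0 R0 s 2 oD hq hp' cr' hin hs).
  cbv beta iota in A0, A1, A2, B0, B2.
  assert (X := is_RInt_plus (V := R_NormedModule) _ _ _ _ _ _ A1
   (is_RInt_plus (V := R_NormedModule) _ _ _ _ _ _
     (is_RInt_scal (V := R_NormedModule) _ _ _ (a / 2) _
        (is_RInt_plus (V := R_NormedModule) _ _ _ _ _ _ A0 A2))
     (is_RInt_scal (V := R_NormedModule) _ _ _ (b / 2) _
        (is_RInt_minus (V := R_NormedModule) _ _ _ _ _ _ B0 B2)))).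
  apply is_RInt_unique.
  refine (eq_ind _ (fun l => is_RInt (dg s) 0 (2 * PI) l) _ _ _).
  2:{ refine (_ : plus 0 (plus (scal (a / 2) (plus (2 * PI * p x0 y0) 0))
              (scal (b / 2) (minus (2 * PI * q x0 y0) 0))) = _).
      unfold plus, scal, minus, opp, plus; simpl; unfold mult; simpl; field. }
  revert X; apply is_RInt_ext; intros t _.
  unfold dg, w, plus, scal, minus, opp, plus; simpl; unfold mult; simpl.
  rewrite !Rmult_0_l, !Rmult_1_l, cos_0, sin_0.
  replace ((1 + 1) * t) with (2 * t) by ring.
  rewrite cos_2a, sin_2a.
  generalize (p (x0 + s * cos t) (y0 + s * sin t)) (q (x0 + s * cos t) (y0 + s * sin t)).
  intros P Q; pose proof (sin2_cos2 t) as e; unfold Rsqr in e.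
  replace (sin t * sin t) with (1 - cos t * cos t) by lra.
  transitivity ((P * cos t + Q * sin t) * (1 + a * cos t) +
    b * (P * sin t * cos t) + b * Q * (sin t * sin t)); [| ring].
  replace (sin t * sin t) with (1 - cos t * cos t) by lra.
  field. }
assert (J : RInt (g r) 0 (2 * PI) - RInt (g 0) 0 (2 * PI) =
  PI * (a * p x0 y0 + b * q x0 y0) * (r - 0)).
{ destruct (MVT_gen (fun s => RInt (g s) 0 (2 * PI)) 0 r
    (fun _ => PI * (a * p x0 y0 + b * q x0 y0))) as [c [_ hc]].
  - rewrite Rmin_left, Rmax_right by lra; intros s hs.
    assert (hs' : Rabs s < R0) by (apply Rabs_def1; lra).
    rewrite <- (V s) by lra; apply dA; exact hs'.
  - rewrite Rmin_left, Rmax_right by lra; intros s hs.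
    assert (hs' : Rabs s < R0) by (apply Rabs_def1; lra).
    apply continuity_pt_filterlim.
    apply (ex_derive_continuous (V := R_NormedModule) (fun s => RInt (g s) 0 (2 * PI))).
    exists (RInt (dg s) 0 (2 * PI)); exact (dA s hs').
  - exact hc. }
assert (J0 : RInt (g 0) 0 (2 * PI) = 2 * PI * H x0 y0).
{ apply is_RInt_unique.
  pose (W := fun t => H x0 y0 * (t + a * sin t - b * cos t)).
  assert (i : is_RInt (g 0) 0 (2 * PI) (minus (W (2 * PI)) (W 0))).
  { apply (is_RInt_derive (V := R_CompleteNormedModule) W).
    - intros t _; unfold W, g, w; rewrite !Rmult_0_l, !Rplus_0_r.
      auto_derive; [trivial | ring].
    - intros t _; apply continuity_2d_slice; apply cP.
      rewrite Rabs_R0; lra. }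
  refine (eq_ind _ (fun l => is_RInt (g 0) 0 (2 * PI) l) i _ _).
  unfold W; rewrite sin_2PI, cos_2PI, sin_0, cos_0.
  unfold minus, plus, opp; simpl; ring. }
assert (hr' : Rabs r < R0) by (apply Rabs_def1; lra).
pose proof PI_RGT_0 as hpi.
assert (Jp : 0 <= RInt (g r) 0 (2 * PI)).
{ apply RInt_ge_0; [lra | |].
  - apply (ex_RInt_continuous (V := R_CompleteNormedModule)).
    intros t _; apply continuity_2d_slice; auto.
  - intros t _; unfold g; apply Rmult_le_pos.
    + apply pos; eapply circle_in; eauto.
    + now apply unit_combination_le. }
assert (f : 0 <= 2 * H x0 y0 + r * (a * p x0 y0 + b * q x0 y0)).
{ apply (Rmult_le_reg_l PI); [exact hpi |]; lra. }
apply (Rmult_le_reg_l r); [lra |].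
replace (r * (- (2 / r) * H x0 y0)) with (- (2 * H x0 y0)) by (field; lra).
lra.
Qed.

Lemma Cmod_pair (x y : R) : Cmod (x, y) = sqrt (x ^ 2 + y ^ 2).
Proof. reflexivity. Qed.

Lemma in_region_unit_disc (x0 y0 R0 : R) :
  0 <= R0 -> Cmod (x0, y0) + R0 <= 1 -> in_region unit_disc x0 y0 R0.
Proof.
intros h0 h u v huv.
apply disc_unit_disc.
replace (u, v) with (Cplus (x0, y0) (u - x0, v - y0)).
2:{ unfold Cplus; simpl; f_equal; ring. }
unfold Defs.disc; eapply Rle_lt_trans; [apply Cmod_triangle |].
assert (Cmod (u - x0, v - y0) < R0); [| lra].
rewrite Cmod_pair, <- (sqrt_pow2 R0) by lra.
apply sqrt_lt_1_alt; split; [| exact huv].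
pose proof (pow2_ge_0 (u - x0)); pose proof (pow2_ge_0 (v - y0)); lra.
Qed.

(* Along the segment from [z] to [z'], the derivative of [H] is at least
   [- (2 / r) H], by the gradient bound. *)
Lemma harnack_C1 (H p p1 p2 q q1 q2 : R -> R -> R) (x y x' y' r : R) :
  (forall u v, unit_disc u v -> C1_at H p q u v) ->
  (forall u v, unit_disc u v -> C1_at p p1 p2 u v) ->
  (forall u v, unit_disc u v -> C1_at q q1 q2 u v) ->
  (forall u v, unit_disc u v -> p1 u v + q2 u v = 0 /\ p2 u v = q1 u v) ->
  (forall u v, unit_disc u v -> 0 <= H u v) ->
  0 < r -> Cmod (x, y) + Cmod (x' - x, y' - y) + r < 1 ->
  H x y <= exp (2 * Cmod (x' - x, y' - y) / r) * H x' y'.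
Proof.
intros hH hp hq cr pos hr hin.
set (l := Cmod (x' - x, y' - y)) in *.
assert (hl : 0 <= l) by apply Cmod_ge_0.
pose proof (Cmod_ge_0 (x, y)) as hz.
destruct hl as [hl | hl].
2:{ assert (E : (x' - x, y' - y) = RtoC 0) by (apply Cmod_eq_0; symmetry; exact hl).
    injection E; intros e1 e2.
    rewrite <- hl, Rmult_0_r; unfold Rdiv; rewrite Rmult_0_l, exp_0, Rmult_1_l.
    replace x' with x by lra; replace y' with y by lra; lra. }
pose (a := (x' - x) / l); pose (b := (y' - y) / l).
assert (hab : a ^ 2 + b ^ 2 = 1).
{ assert (l ^ 2 = (x' - x) ^ 2 + (y' - y) ^ 2).
  { unfold l; rewrite Cmod_pair, pow2_sqrt; [reflexivity |].
    pose proof (pow2_ge_0 (x' - x)); pose proof (pow2_ge_0 (y' - y)); lra. }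
  transitivity (((x' - x) ^ 2 + (y' - y) ^ 2) / l ^ 2); [unfold a, b; field; lra |].
  rewrite <- H0; field; lra. }
assert (ia : forall s, Cmod (s * a, s * b) = Rabs s).
{ intros s; rewrite Cmod_pair, <- sqrt_Rsqr_abs; f_equal; unfold Rsqr; nra. }
(* The radius is the midpoint between [r] and [1 - Cmod (x, y) - l]: strictly above [r], as
   [gradient_bound] demands, and small enough for the disc about each point of the segment to stay
   in the unit disc. *)
assert (sd : forall s, 0 <= s <= l ->
  in_region unit_disc (x + s * a) (y + s * b) ((1 - Cmod (x, y) - l + r) / 2 )
  /\ unit_disc (x + s * a) (y + s * b)).
{ intros s hs.
  assert (T : Cmod (x + s * a, y + s * b) <= Cmod (x, y) + s).
  { replace (x + s * a, y + s * b) with (Cplus (x, y) (s * a, s * b)) by reflexivity.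
    eapply Rle_trans; [apply Cmod_triangle |].
    rewrite ia, Rabs_pos_eq by lra; lra. }
  split.
  - apply in_region_unit_disc; lra.
  - apply disc_unit_disc; unfold Defs.disc; lra. }
assert (LH := locally_2d_C1 _ _ _ _ unit_disc_open hH).
(* The integrating factor [exp (2 / r * s)] turns the lower bound for the derivative of [H] into
   monotonicity of [f]. *)
pose (f := fun s => H (x + s * a) (y + s * b) * exp (2 / r * s)).
pose (df := fun s =>
  (p (x + s * a) (y + s * b) * a + q (x + s * a) (y + s * b) * b) * exp (2 / r * s) +
  H (x + s * a) (y + s * b) * (2 / r * exp (2 / r * s))).
assert (hf : forall s, 0 <= s <= l -> is_derive f s (df s)).
{ intros s hs; destruct (sd s hs) as [_ d].
  assert (e1 : is_derive (fun s => H (x + s * a) (y + s * b)) s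
    (p (x + s * a) (y + s * b) * a + q (x + s * a) (y + s * b) * b)).
  { apply (C1_comp H p q (fun s => x + s * a) (fun s => y + s * b)); [auto | |];
      auto_derive; solve [trivial | ring]. }
  assert (e2 : is_derive (fun s => exp (2 / r * s)) s (2 / r * exp (2 / r * s)))
    by (auto_derive; [trivial | ring]).
  exact (is_derive_mult _ _ _ _ _ e1 e2 Rmult_comm). }
destruct (MVT_gen f 0 l df) as [c [hc e]].
{ rewrite Rmin_left, Rmax_right by lra; intros s hs; apply hf; lra. }
{ rewrite Rmin_left, Rmax_right by lra; intros s hs.
  apply derivable_continuous_pt; exists (df s); apply is_derive_Reals; auto. }
rewrite Rmin_left, Rmax_right in hc by lra.
destruct (sd c hc) as [d1 d2].
assert (g := gradient_bound H p p1 p2 q q1 q2 unit_disc (x + c * a) (y + c * b) _ r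
  a b unit_disc_open hH hp hq cr pos d1).
assert (g' : - (2 / r) * H (x + c * a) (y + c * b) <=
  a * p (x + c * a) (y + c * b) + b * q (x + c * a) (y + c * b)) by (apply g; lra).
assert (mono : f 0 <= f l).
{ assert (0 <= f l - f 0); [rewrite e; unfold df | lra].
  apply Rmult_le_pos; [| lra].
  pose proof (exp_pos (2 / r * c)) as ep.
  match goal with |- 0 <= ?A => replace A with
    (((a * p (x + c * a) (y + c * b) + b * q (x + c * a) (y + c * b)) -
      - (2 / r) * H (x + c * a) (y + c * b)) * exp (2 / r * c)) by ring end.
  apply Rmult_le_pos; lra. }
unfold f in mono.
rewrite !Rmult_0_l, Rmult_0_r, !Rplus_0_r, exp_0, Rmult_1_r in mono.
replace (x + l * a) with x' in mono by (unfold a; field; lra).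
replace (y + l * b) with y' in mono by (unfold b; field; lra).
replace (2 * l / r) with (2 / r * l) by (field; lra).
rewrite Rmult_comm; exact mono.
Qed.

(** * Harmonicity through explicit partial derivatives *)

Lemma Har_plus_C2 (H : C -> R) :
  Har_plus H -> exists p p1 p2 q q1 q2 : R -> R -> R,
    (forall u v, unit_disc u v -> C1_at (fun x y => H (x, y)) p q u v) /\
    (forall u v, unit_disc u v -> C1_at p p1 p2 u v) /\
    (forall u v, unit_disc u v -> C1_at q q1 q2 u v) /\
    (forall u v, unit_disc u v -> p1 u v + q2 u v = 0 /\ p2 u v = q1 u v).
Proof.
intros [hH _].
pose (f := fun u v => H (u, v)).
pose (p := fun u v => Derive (fun z => f z v) u).
pose (q := fun u v => Derive (fun z => f u z) v).
exists p, (fun u v => Derive (fun z => p z v) u), (fun u v => Derive (fun z => p u z) v),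
  q, (fun u v => Derive (fun z => q z v) u), (fun u v => Derive (fun z => q u z) v).
assert (K : forall u v, unit_disc u v ->
  C1_at f p q u v /\
  C1_at p (fun u v => Derive (fun z => p z v) u) (fun u v => Derive (fun z => p u z) v) u v /\
  C1_at q (fun u v => Derive (fun z => q z v) u) (fun u v => Derive (fun z => q u z) v) u v /\
  Derive (fun z => p z v) u + Derive (fun z => q u z) v = 0).
{ intros u v d; apply disc_unit_disc in d.
  destruct (hH u v d) as [[_ [a1 [a2 [[b0 [b1 [b2 [[b3 _] [b4 _]]]]]
    [c0 [c1 [c2 [[c3 _] [c4 _]]]]]]]]] e].
  split; [| split; [| split]].
  - split; [| split; [| split]]; [apply Derive_correct; exact a1 |
      apply Derive_correct; exact a2 | exact b0 | exact c0].
  - split; [| split; [| split]]; [apply Derive_correct; exact b1 |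
      apply Derive_correct; exact b2 | exact b3 | exact b4].
  - split; [| split; [| split]]; [apply Derive_correct; exact c1 |
      apply Derive_correct; exact c2 | exact c3 | exact c4].
  - exact e. }
split; [| split; [| split]]; try (intros u v d; apply (K u v d)).
intros u v d; split; [apply (K u v d) |].
(* Laplace's equation is one Cauchy-Riemann equation for [p - i q]; the symmetry of the mixed
   derivatives is the other. *)
symmetry; apply (Schwarz f).
- destruct (unit_disc_open u v d) as [e he]; exists e; intros a b ha hb.
  destruct (K a b (he a b ha hb)) as [[k1 [k2 _]] [[_ [k3 _]] [[k4 _] _]]].
  split; [| split; [| split]]; eexists; eassumption.
- apply (K u v d).
- apply (K u v d).
Qed.

(** [ex_diff_n] iterates [Derive], and an explicit first partial derivative [f] agrees with the
    corresponding [Derive] on a neighbourhood only; [g] stands for that [Derive]. *)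
Lemma C1_ex_diff_n (f f1 f2 g : R -> R -> R) (x y : R) :
  locally_2d (C1_at f f1 f2) x y -> locally_2d (fun u v => f u v = g u v) x y ->
  ex_diff_n g 1 x y.
Proof.
intros h hg; apply (ex_diff_n_ext_loc f g); [exact hg |].
destruct (locally_2d_singleton _ _ _ h) as [h1 [h2 [c1 c2]]].
split; [eapply C1_continuity; eauto |].
split; [eexists; eauto |].
split; [eexists; eauto |].
split; (split; [| exact I]).
- apply (continuity_2d_pt_ext_loc f1); [| exact c1].
  destruct h as [e he]; exists e; intros u v hu hv.
  symmetry; apply is_derive_unique; apply (he u v hu hv).
- apply (continuity_2d_pt_ext_loc f2); [| exact c2].
  destruct h as [e he]; exists e; intros u v hu hv.
  symmetry; apply is_derive_unique; apply (he u v hu hv).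
Qed.

(** The way back to [harmonic_disc] for functions whose partial derivatives are at hand: linear
    combinations and Poisson series. *)
Lemma C2_harmonic_disc (H : C -> R) (p p1 p2 q q1 q2 : R -> R -> R) :
  (forall u v, unit_disc u v -> C1_at (fun x y => H (x, y)) p q u v) ->
  (forall u v, unit_disc u v -> C1_at p p1 p2 u v) ->
  (forall u v, unit_disc u v -> C1_at q q1 q2 u v) ->
  (forall u v, unit_disc u v -> p1 u v + q2 u v = 0) ->
  harmonic_disc H.
Proof.
intros hH hp hq cr x y d; apply disc_unit_disc in d.
assert (LH := locally_2d_C1 _ _ _ _ unit_disc_open hH x y d).
assert (Lp := locally_2d_C1 _ _ _ _ unit_disc_open hp x y d).
assert (Lq := locally_2d_C1 _ _ _ _ unit_disc_open hq x y d).
assert (ep : locally_2d (fun u v => p u v = Derive (fun z => H (z, v)) u) x y).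
{ destruct LH as [e he]; exists e; intros u v hu hv.
  symmetry; apply is_derive_unique; apply (he u v hu hv). }
assert (eq : locally_2d (fun u v => q u v = Derive (fun z => H (u, z)) v) x y).
{ destruct LH as [e he]; exists e; intros u v hu hv.
  symmetry; apply is_derive_unique; apply (he u v hu hv). }
split.
- split; [eapply C1_continuity; exact LH |].
  destruct (hH x y d) as [h1 [h2 _]].
  split; [eexists; exact h1 |].
  split; [eexists; exact h2 |].
  split; [exact (C1_ex_diff_n _ _ _ _ _ _ Lp ep) | exact (C1_ex_diff_n _ _ _ _ _ _ Lq eq)].
- change (Derive (fun u => Derive (fun z => H (z, y)) u) x +
          Derive (fun v => Derive (fun z => H (x, z)) v) y = 0).
  rewrite <- (cr x y d); f_equal; apply is_derive_unique.
  + apply (is_derive_ext_loc (fun u => p u y)).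
    * apply locally_2d_1d_const_y in ep; exact ep.
    * apply (hp x y d).
  + apply (is_derive_ext_loc (fun v => q x v)).
    * apply locally_2d_1d_const_x in eq; exact eq.
    * apply (hq x y d).
Qed.

Lemma C1_lincomb (f f1 f2 g g1 g2 : R -> R -> R) (a b x y : R) :
  C1_at f f1 f2 x y -> C1_at g g1 g2 x y ->
  C1_at (fun u v => a * f u v + b * g u v) (fun u v => a * f1 u v + b * g1 u v)
    (fun u v => a * f2 u v + b * g2 u v) x y.
Proof.
intros [h1 [h2 [h3 h4]]] [k1 [k2 [k3 k4]]].
split; [| split; [| split]].
- exact (is_derive_plus (V := R_NormedModule) _ _ _ _ _
    (is_derive_scal _ _ a _ h1) (is_derive_scal _ _ b _ k1)).
- exact (is_derive_plus (V := R_NormedModule) _ _ _ _ _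
    (is_derive_scal _ _ a _ h2) (is_derive_scal _ _ b _ k2)).
- apply continuity_2d_pt_plus; apply continuity_2d_pt_mult;
    solve [apply continuity_2d_pt_const | assumption].
- apply continuity_2d_pt_plus; apply continuity_2d_pt_mult;
    solve [apply continuity_2d_pt_const | assumption].
Qed.

Lemma Har_plus_lincomb (F G : C -> R) (a b : R) :
  Har_plus F -> Har_plus G -> 0 < a -> 0 < b ->
  Har_plus (fun z => a * F z + b * G z).
Proof.
intros hF hG ha hb; split.
- destruct (Har_plus_C2 F hF) as [p [p1 [p2 [q [q1 [q2 [h1 [h2 [h3 h4]]]]]]]]].
  destruct (Har_plus_C2 G hG) as [r [r1 [r2 [s [s1 [s2 [k1 [k2 [k3 k4]]]]]]]]].
  eapply (C2_harmonic_disc _ (fun u v => a * p u v + b * r u v) _ _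
    (fun u v => a * q u v + b * s u v)).
  + intros u v d; apply (C1_lincomb (fun x y => F (x, y)) _ _ (fun x y => G (x, y)));
      auto.
  + intros u v d; apply C1_lincomb; auto.
  + intros u v d; apply C1_lincomb; auto.
  + intros u v d; simpl.
    destruct (h4 u v d) as [e _]; destruct (k4 u v d) as [e' _].
    replace (q2 u v) with (- p1 u v) by lra.
    replace (s2 u v) with (- r1 u v) by lra; ring.
- intros z d; destruct hF as [_ hF]; destruct hG as [_ hG].
  apply Rplus_lt_0_compat; apply Rmult_lt_0_compat; auto.
Qed.

Lemma harnack (H : C -> R) (z z' : C) (r : R) :
  Har_plus H -> 0 < r -> Cmod z + Cmod (z' - z) + r < 1 ->
  H z <= exp (2 * Cmod (z' - z) / r) * H z'.
Proof.
intros hH hr hin; destruct z as [x y]; destruct z' as [x' y'].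
destruct (Har_plus_C2 H hH) as [p [p1 [p2 [q [q1 [q2 [h1 [h2 [h3 h4]]]]]]]]].
apply (harnack_C1 (fun u v => H (u, v)) p p1 p2 q q1 q2); auto.
intros u v d; left; apply hH; apply disc_unit_disc; exact d.
Qed.

(** * Poisson series *)

(** A quadratic bound on the remainder is stable under summation with weights, so this criterion
    lets a series be differentiated by adding up termwise Taylor estimates. *)
Lemma is_derive_quadratic (f : R -> R) (x l K d : R) :
  0 < d ->
  (forall z, Rabs (z - x) < d -> Rabs (f z - f x - l * (z - x)) <= K * (z - x) ^ 2) ->
  is_derive f x l.
Proof.
intros hd h; apply is_derive_Reals; intros eps heps.
pose proof (Rabs_pos K) as hK.
assert (hm : 0 < Rmin d (eps / (Rabs K + 1))).
{ apply Rmin_pos; [exact hd | apply Rdiv_lt_0_compat; lra]. }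
exists (mkposreal _ hm); simpl; intros s s0 hs.
pose proof (Rmin_l d (eps / (Rabs K + 1))) as m1.
pose proof (Rmin_r d (eps / (Rabs K + 1))) as m2.
pose proof (Rabs_pos_lt s s0) as hs'.
specialize (h (x + s)); replace (x + s - x) with s in h by ring.
assert (b := h ltac:(lra)).
replace ((f (x + s) - f x) / s - l) with ((f (x + s) - f x - l * s) / s) by (field; lra).
unfold Rdiv; rewrite Rabs_mult, Rabs_inv.
apply (Rmult_lt_reg_r (Rabs s)); [exact hs' |].
rewrite Rmult_assoc, Rinv_l, Rmult_1_r by lra.
eapply Rle_lt_trans; [exact b |].
rewrite <- (pow2_abs s); pose proof (Rle_abs K).
assert (b2 : Rabs s < eps / (Rabs K + 1)) by lra.
assert (b3 : Rabs s * (Rabs K + 1) < eps).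
{ apply (Rmult_lt_compat_r (Rabs K + 1)) in b2; [| lra].
  replace (eps / (Rabs K + 1) * (Rabs K + 1)) with eps in b2 by (field; lra).
  exact b2. }
nra.
Qed.

Lemma continuity_2d_lipschitz (f : R -> R -> R) (x y K d : R) :
  0 < d ->
  (forall u v, Rabs (u - x) < d -> Rabs (v - y) < d ->
     Rabs (f u v - f x y) <= K * (Rabs (u - x) + Rabs (v - y))) ->
  continuity_2d_pt f x y.
Proof.
intros hd h eps.
pose proof (Rabs_pos K) as hK; pose proof (cond_pos eps) as he.
assert (hm : 0 < Rmin d (eps / (2 * (Rabs K + 1)))).
{ apply Rmin_pos; [exact hd | apply Rdiv_lt_0_compat; lra]. }
exists (mkposreal _ hm); simpl; intros u v hu hv.
pose proof (Rmin_l d (eps / (2 * (Rabs K + 1)))) as m1.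
pose proof (Rmin_r d (eps / (2 * (Rabs K + 1)))) as m2.
eapply Rle_lt_trans; [apply h; lra |].
set (e := eps / (2 * (Rabs K + 1))) in *.
assert (eps = 2 * e * (Rabs K + 1) :> R) by (unfold e; field; lra).
pose proof (Rle_abs K); pose proof (Rabs_pos (u - x)); pose proof (Rabs_pos (v - y)).
nra.
Qed.

(** * Series with summable weights *)

Definition wsum (w c : nat -> R) : R := Series (fun n => w n * c n).

Definition bounded_seq (c : nat -> R) : Prop := exists K, forall n, Rabs (c n) <= K.

Lemma ex_wsum (w c : nat -> R) :
  (forall n, 0 <= w n) -> ex_series w -> bounded_seq c ->
  ex_series (fun n => w n * c n).
Proof.
intros hw sw [K hK].
apply (ex_series_le (V := R_CompleteNormedModule) _ (fun n => w n * K)).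
- intros n; change (Rabs (w n * c n) <= w n * K).
  rewrite Rabs_mult, (Rabs_pos_eq (w n)) by auto.
  apply Rmult_le_compat_l; auto.
- apply (ex_series_ext (fun n => K * w n)); [intros n; apply Rmult_comm |].
  apply (ex_series_scal_l (V := R_NormedModule)); exact sw.
Qed.

Lemma wsum_le (w c : nat -> R) (K : R) :
  (forall n, 0 <= w n) -> ex_series w -> (forall n, Rabs (c n) <= K) ->
  Rabs (wsum w c) <= K * Series w.
Proof.
intros hw sw hK.
assert (e : ex_series (fun n => K * w n))
  by (apply (ex_series_scal_l (V := R_NormedModule)); exact sw).
assert (hb : forall n, 0 <= Rabs (w n * c n) <= K * w n).
{ intros n; split; [apply Rabs_pos |].
  rewrite Rabs_mult, (Rabs_pos_eq (w n)), Rmult_comm by auto.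
  apply Rmult_le_compat_r; auto. }
rewrite <- Series_scal_l.
eapply Rle_trans; [apply Series_Rabs | apply Series_le; assumption].
apply (ex_series_le (V := R_CompleteNormedModule) _ (fun n => K * w n)); [| exact e].
intros n; change (Rabs (Rabs (w n * c n)) <= K * w n).
rewrite Rabs_Rabsolu; apply hb.
Qed.

Lemma wsum_lincomb (w a b : nat -> R) (s t : R) :
  (forall n, 0 <= w n) -> ex_series w -> bounded_seq a -> bounded_seq b ->
  wsum w (fun n => s * a n + t * b n) = s * wsum w a + t * wsum w b.
Proof.
intros hw sw ha hb; unfold wsum.
assert (ea := ex_wsum w a hw sw ha); assert (eb := ex_wsum w b hw sw hb).
rewrite <- !Series_scal_l, <- Series_plus.
- apply Series_ext; intros n; ring.
- apply (ex_series_scal_l (V := R_NormedModule)); exact ea.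
- apply (ex_series_scal_l (V := R_NormedModule)); exact eb.
Qed.

Lemma bounded_lincomb (a b : nat -> R) (s t : R) :
  bounded_seq a -> bounded_seq b -> bounded_seq (fun n => s * a n + t * b n).
Proof.
intros [A ha] [B hb]; exists (Rabs s * A + Rabs t * B); intros n.
eapply Rle_trans; [apply Rabs_triang |]; rewrite !Rabs_mult.
apply Rplus_le_compat; apply Rmult_le_compat_l; auto using Rabs_pos.
Qed.

Lemma wsum_continuity (w : nat -> R) (f : nat -> R -> R -> R) (x y K d : R) :
  (forall n, 0 <= w n) -> ex_series w -> 0 < d ->
  (forall n u v, Rabs (u - x) < d -> Rabs (v - y) < d -> Rabs (f n u v) <= K) ->
  (forall n u v, Rabs (u - x) < d -> Rabs (v - y) < d ->
     Rabs (f n u v - f n x y) <= K * (Rabs (u - x) + Rabs (v - y))) ->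
  continuity_2d_pt (fun u v => wsum w (fun n => f n u v)) x y.
Proof.
intros hw sw hd hb hl.
apply (continuity_2d_lipschitz _ x y (K * Series w) d); [exact hd |].
intros u v hu hv.
assert (b0 : bounded_seq (fun n => f n x y)).
{ exists K; intros n; apply hb; rewrite Rminus_diag, Rabs_R0; exact hd. }
assert (b1 : bounded_seq (fun n => f n u v)) by (exists K; auto).
replace (wsum w (fun n => f n u v) - wsum w (fun n => f n x y))
  with (wsum w (fun n => 1 * f n u v + (-1) * f n x y)).
2:{ rewrite wsum_lincomb by assumption; ring. }
replace (K * Series w * (Rabs (u - x) + Rabs (v - y)))
  with ((K * (Rabs (u - x) + Rabs (v - y))) * Series w) by ring.
apply wsum_le; auto; intros n.
replace (1 * f n u v + -1 * f n x y) with (f n u v - f n x y) by ring; auto.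
Qed.

Lemma wsum_is_derive (w : nat -> R) (f : nat -> R -> R) (l : nat -> R) (x K d : R) :
  (forall n, 0 <= w n) -> ex_series w -> 0 < d ->
  (forall n u, Rabs (u - x) < d -> Rabs (f n u) <= K) ->
  (forall n, Rabs (l n) <= K) ->
  (forall n u, Rabs (u - x) < d ->
     Rabs (f n u - f n x - l n * (u - x)) <= K * (u - x) ^ 2) ->
  is_derive (fun u => wsum w (fun n => f n u)) x (wsum w l).
Proof.
intros hw sw hd hb hbl hl.
apply (is_derive_quadratic _ x _ (K * Series w) d); [exact hd |].
intros u hu.
assert (b0 : bounded_seq (fun n => f n x)).
{ exists K; intros n; apply hb; rewrite Rminus_diag, Rabs_R0; exact hd. }
assert (b1 : bounded_seq (fun n => f n u)) by (exists K; auto).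
assert (b2 : bounded_seq l) by (exists K; auto).
(* The remainder of the sum is rewritten as the sum of the remainders; the nested shape lets
   [wsum_lincomb] apply twice. *)
replace (wsum w (fun n => f n u) - wsum w (fun n => f n x) - wsum w l * (u - x))
  with (wsum w (fun n => 1 * (1 * f n u + (-1) * f n x) + - (u - x) * l n)).
2:{ rewrite !wsum_lincomb; auto using bounded_lincomb; ring. }
replace (K * Series w * (u - x) ^ 2) with ((K * (u - x) ^ 2) * Series w) by ring.
apply wsum_le; auto; intros n.
replace (1 * (1 * f n u + -1 * f n x) + - (u - x) * l n)
  with (f n u - f n x - l n * (u - x)) by ring; auto.
Qed.

(* Termwise Taylor estimates of order two, uniform in [n], around every point of
   the disc: [g' n] is the complex derivative of [g n]. *)
Definition taylor_family (g g' : nat -> C -> C) : Prop :=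
  forall z, Defs.disc z -> exists d K : R, 0 < d /\ 0 <= K /\
    forall n w, Cmod (w - z) < d ->
      Cmod (g n w) <= K /\ Cmod (g' n w) <= K /\
      Cmod (g n w - g n z - g' n z * (w - z))%C <= K * Cmod (w - z) ^ 2 /\
      Cmod (g' n w - g' n z) <= K * Cmod (w - z).

Lemma Re_mult_le (c z : C) (K : R) : Cmod z <= K -> Rabs (Re (c * z)%C) <= Cmod c * K.
Proof.
intros h; eapply Rle_trans; [apply re_le_Cmod |].
rewrite Cmod_mult; apply Rmult_le_compat_l; [apply Cmod_ge_0 | exact h].
Qed.

Lemma Cmod_horizontal (s u v : R) : Cmod ((s, v) - (u, v))%C = Rabs (s - u).
Proof.
replace ((s, v) - (u, v))%C with (RtoC (s - u)).
- apply Cmod_R.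
- unfold Cminus, Cplus, Copp, RtoC; simpl; f_equal; ring.
Qed.

Lemma Cmod_vertical (s u v : R) : Cmod ((u, s) - (u, v))%C = Rabs (s - v).
Proof.
replace ((u, s) - (u, v))%C with (Ci * RtoC (s - v))%C.
- rewrite Cmod_mult, Cmod_R; unfold Cmod, Ci; simpl.
  replace (0 * (0 * 1) + 1 * (1 * 1)) with 1 by ring; rewrite sqrt_1; ring.
- unfold Cminus, Cplus, Copp, RtoC, Cmult, Ci; simpl; f_equal; ring.
Qed.

Lemma Cmod_box (s t u v d : R) :
  Rabs (s - u) < d / 2 -> Rabs (t - v) < d / 2 -> Cmod ((s, t) - (u, v))%C < d.
Proof.
intros h1 h2.
replace ((s, t) - (u, v))%C with (((s, t) - (u, t)) + ((u, t) - (u, v)))%C by ring.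
eapply Rle_lt_trans; [apply Cmod_triangle |].
rewrite Cmod_horizontal, Cmod_vertical; lra.
Qed.

Lemma wsum_continuity_complex (w : nat -> R) (c : C) (g : nat -> C -> C) (u v d K : R) :
  (forall n, 0 <= w n) -> ex_series w -> 0 < d -> 0 <= K ->
  (forall n z, Cmod (z - (u, v)) < d ->
     Cmod (g n z) <= K /\ Cmod (g n z - g n (u, v)) <= K * Cmod (z - (u, v))) ->
  continuity_2d_pt (fun s t => wsum w (fun n => Re (c * g n (s, t))%C)) u v.
Proof.
intros hw sw hd hK h.
apply (wsum_continuity w (fun n s t => Re (c * g n (s, t))%C) u v (Cmod c * K) (d / 2));
  auto; [lra | |].
- intros n s t hs ht; apply Re_mult_le; apply h; apply Cmod_box; assumption.
- intros n s t hs ht.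
  destruct (h n (s, t)) as [_ e]; [apply Cmod_box; assumption |].
  replace (Re (c * g n (s, t))%C - Re (c * g n (u, v))%C)
    with (Re (c * (g n (s, t) - g n (u, v)))%C).
  2:{ unfold Re, Cmult, Cminus, Cplus, Copp; simpl; ring. }
  rewrite Rmult_assoc; apply Re_mult_le.
  eapply Rle_trans; [exact e |]; apply Rmult_le_compat_l; [exact hK |].
  replace ((s, t) - (u, v))%C with (((s, t) - (u, t)) + ((u, t) - (u, v)))%C by ring.
  eapply Rle_trans; [apply Cmod_triangle |].
  rewrite Cmod_horizontal, Cmod_vertical; lra.
Qed.

(** For holomorphic [g] the partial derivatives of [Re (c g)] are [Re (c g')] and [Re (c i g')],
    again of the same form. The free factor [c] thus allows the lemma to be applied again to each
    first derivative, with [c] and [c * Ci]. *)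
Lemma wsum_C1 (w : nat -> R) (g g' : nat -> C -> C) (c : C) (u v : R) :
  (forall n, 0 <= w n) -> ex_series w -> taylor_family g g' -> unit_disc u v ->
  C1_at (fun s t => wsum w (fun n => Re (c * g n (s, t))%C))
        (fun s t => wsum w (fun n => Re (c * g' n (s, t))%C))
        (fun s t => wsum w (fun n => Re (c * Ci * g' n (s, t))%C)) u v.
Proof.
intros hw sw hg hd.
apply disc_unit_disc in hd; destruct (hg _ hd) as [d [K [dpos [Kpos h]]]].
assert (h0 : forall n, Cmod (g' n (u, v)) <= K).
{ intros n; apply h.
  replace ((u, v) - (u, v))%C with (RtoC 0) by ring; rewrite Cmod_0; exact dpos. }
assert (iC : forall z, Cmod (Ci * z) = Cmod z).
{ intros z; rewrite Cmod_mult; unfold Cmod at 1, Ci; simpl.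
  replace (0 * (0 * 1) + 1 * (1 * 1)) with 1 by ring; rewrite sqrt_1; ring. }
split; [| split; [| split]].
- apply (wsum_is_derive w (fun n s => Re (c * g n (s, v))%C) _ u (Cmod c * K) d); auto.
  + intros n s hs; apply Re_mult_le; apply h; rewrite Cmod_horizontal; exact hs.
  + intros n; apply Re_mult_le; auto.
  + intros n s hs; destruct (h n (s, v)) as [_ [_ [e _]]];
      [rewrite Cmod_horizontal; exact hs |].
    rewrite Cmod_horizontal, pow2_abs in e.
    rewrite Rmult_assoc.
    eapply Rle_trans; [| apply (Re_mult_le c _ _ e)]; right; f_equal.
    unfold Re, Cmult, Cminus, Cplus, Copp; simpl; ring.
- apply (wsum_is_derive w (fun n s => Re (c * g n (u, s))%C) _ v (Cmod c * K) d); auto.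
  + intros n s hs; apply Re_mult_le; apply h; rewrite Cmod_vertical; exact hs.
  + intros n; rewrite <- Cmult_assoc; apply Re_mult_le; rewrite iC; auto.
  + intros n s hs; destruct (h n (u, s)) as [_ [_ [e _]]];
      [rewrite Cmod_vertical; exact hs |].
    rewrite Cmod_vertical, pow2_abs in e.
    rewrite Rmult_assoc.
    eapply Rle_trans; [| apply (Re_mult_le c _ _ e)]; right; f_equal.
    unfold Re, Cmult, Cminus, Cplus, Copp, Ci; simpl; ring.
- apply (wsum_continuity_complex w c g' u v d K); auto.
  intros n z hz; split; apply (h n z hz).
- apply (wsum_continuity_complex w (c * Ci) g' u v d K); auto.
  intros n z hz; split; apply (h n z hz).
Qed.

Lemma Cmod_sub_ge (b z : C) (d : R) :
  Cmod b <= 1 -> Cmod z <= 1 - d -> 0 < d ->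
  d <= Cmod (1 - b * z) /\ (1 - b * z <> 0)%C.
Proof.
intros hb hz hd.
assert (e : d <= Cmod (1 - b * z)).
{ assert (t := Cmod_triangle (1 - b * z) (b * z)).
  replace (1 - b * z + b * z)%C with (RtoC 1) in t by ring.
  rewrite Cmod_1, Cmod_mult in t.
  pose proof (Cmod_ge_0 b); pose proof (Cmod_ge_0 z); nra. }
split; [exact e |].
intros h; rewrite h, Cmod_0 in e; lra.
Qed.

Lemma Cmod_mult_le (a b : C) (A B : R) :
  Cmod a <= A -> Cmod b <= B -> Cmod (a * b) <= A * B.
Proof.
intros ha hb; rewrite Cmod_mult; apply Rmult_le_compat; auto using Cmod_ge_0.
Qed.

Lemma Cmod_plus_le (a b : C) (A B : R) :
  Cmod a <= A -> Cmod b <= B -> Cmod (a + b) <= A + B.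
Proof.
intros ha hb; eapply Rle_trans; [apply Cmod_triangle | lra].
Qed.

Lemma kernel_neighbourhood (b : nat -> C) (z : C) :
  (forall n, Cmod (b n) <= 1) -> Defs.disc z ->
  exists d M : R, 0 < d /\ 1 <= M /\
    forall n w, Cmod (w - z) < d ->
      (1 - b n * w <> 0)%C /\ Cmod (/ (1 - b n * w)) <= M.
Proof.
intros hb hz; unfold Defs.disc in hz; pose proof (Cmod_ge_0 z).
(* For [w] this close to [z], [|1 - b w| >= 1 - |w| >= (1 - |z|) / 2] whatever [n] is. The bound
   [1 <= M] later lets lower powers of [M] be absorbed into [M ^ 4]. *)
exists ((1 - Cmod z) / 2), (2 / (1 - Cmod z)).
split; [lra | split].
- apply (Rmult_le_reg_r (1 - Cmod z)); [lra |]; field_simplify; lra.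
- intros n w hw.
  assert (t := Cmod_triangle (w - z) z).
  replace (w - z + z)%C with w in t by ring.
  destruct (Cmod_sub_ge (b n) w ((1 - Cmod z) / 2)) as [e ne]; [auto | lra | lra |].
  split; [exact ne |].
  rewrite Cmod_inv by exact ne.
  replace (2 / (1 - Cmod z)) with (/ ((1 - Cmod z) / 2)) by (field; lra).
  apply Rinv_le_contravar; lra.
Qed.

(** The remainders are rational functions in which [w - z] or its square factors out exactly, so
    [field] and the bound [M] on the inverses replace complex calculus. *)
Lemma taylor_family_kernel1 (b : nat -> C) :
  (forall n, Cmod (b n) <= 1) ->
  taylor_family (fun n z => / (1 - b n * z))%C
    (fun n z => b n * (/ (1 - b n * z) * / (1 - b n * z)))%C.
Proof.
intros hb z hz; destruct (kernel_neighbourhood b z hb hz) as [d [M [hd [hM h]]]].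
exists d, (3 * M ^ 4); split; [exact hd |].
assert (hM2 : M <= M ^ 2) by nra.
assert (hM3 : M ^ 2 <= M ^ 3) by nra.
assert (hM4 : M ^ 3 <= M ^ 4) by (simpl; nra).
split; [nra |].
intros n w hw.
destruct (h n w hw) as [n1 b1].
destruct (h n z) as [n2 b2].
{ replace (z - z)%C with (RtoC 0) by ring; rewrite Cmod_0; exact hd. }
specialize (hb n); pose proof (Cmod_ge_0 (w - z)) as hp.
assert (rd := Rle_refl (Cmod (w - z))).
split; [nra | split; [| split]].
- eapply Rle_trans; [apply (Cmod_mult_le _ _ 1 (M * M)); auto using Cmod_mult_le |]; nra.
- replace (/ (1 - b n * w) - / (1 - b n * z) -
           b n * (/ (1 - b n * z) * / (1 - b n * z)) * (w - z))%C
    with (b n * b n * (/ (1 - b n * z) * (/ (1 - b n * z) * / (1 - b n * w))) *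
          ((w - z) * (w - z)))%C by (field; split; assumption).
  eapply Rle_trans; [repeat (apply Cmod_mult_le; try eassumption) |].
  replace (1 * 1 * (M * (M * M)) * (Cmod (w - z) * Cmod (w - z)))
    with (M ^ 3 * Cmod (w - z) ^ 2) by ring.
  apply Rmult_le_compat_r; [apply pow2_ge_0 |]; nra.
- replace (b n * (/ (1 - b n * w) * / (1 - b n * w)) -
           b n * (/ (1 - b n * z) * / (1 - b n * z)))%C
    with (b n * b n * (/ (1 - b n * z) * (/ (1 - b n * w) *
           (/ (1 - b n * w) + / (1 - b n * z)))) * (w - z))%C
    by (field; split; assumption).
  eapply Rle_trans.
  + apply (Cmod_mult_le _ _ (1 * 1 * (M * (M * (M + M))))); [| apply Rle_refl].
    repeat (first [apply Cmod_mult_le | apply Cmod_plus_le]; try eassumption).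
  + replace (1 * 1 * (M * (M * (M + M)))) with (2 * M ^ 3) by ring.
    apply Rmult_le_compat_r; [exact hp |]; nra.
Qed.

(** The same for the derivative of the kernel, which makes the Poisson series twice continuously
    differentiable. *)
Lemma taylor_family_kernel2 (b : nat -> C) :
  (forall n, Cmod (b n) <= 1) ->
  taylor_family (fun n z => b n * (/ (1 - b n * z) * / (1 - b n * z)))%C
    (fun n z => 2 * (b n * b n * (/ (1 - b n * z) * (/ (1 - b n * z) * / (1 - b n * z)))))%C.
Proof.
intros hb z hz; destruct (kernel_neighbourhood b z hb hz) as [d [M [hd [hM h]]]].
exists d, (6 * M ^ 4); split; [exact hd |].
assert (hM2 : M <= M ^ 2) by nra.
assert (hM3 : M ^ 2 <= M ^ 3) by nra.
assert (hM4 : M ^ 3 <= M ^ 4) by (simpl; nra).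
split; [nra |].
intros n w hw.
destruct (h n w hw) as [n1 b1].
destruct (h n z) as [n2 b2].
{ replace (z - z)%C with (RtoC 0) by ring; rewrite Cmod_0; exact hd. }
specialize (hb n); pose proof (Cmod_ge_0 (w - z)) as hp.
assert (rd := Rle_refl (Cmod (w - z))).
assert (c2 : Cmod 2 <= 2) by (rewrite Cmod_R, Rabs_pos_eq; lra).
split; [| split; [| split]].
- eapply Rle_trans; [apply (Cmod_mult_le _ _ 1 (M * M)); auto using Cmod_mult_le |]; nra.
- eapply Rle_trans; [repeat (apply Cmod_mult_le; try eassumption) |].
  replace (2 * (1 * 1 * (M * (M * M)))) with (2 * M ^ 3) by ring; nra.
- replace (b n * (/ (1 - b n * w) * / (1 - b n * w)) -
           b n * (/ (1 - b n * z) * / (1 - b n * z)) -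
           2 * (b n * b n * (/ (1 - b n * z) * (/ (1 - b n * z) * / (1 - b n * z)))) *
           (w - z))%C
    with (b n * (b n * b n) * (/ (1 - b n * z) * (/ (1 - b n * z) * (/ (1 - b n * w) *
           (/ (1 - b n * w) + 2 * / (1 - b n * z))))) * ((w - z) * (w - z)))%C
    by (field; split; assumption).
  eapply Rle_trans.
  + apply (Cmod_mult_le _ _ (1 * (1 * 1) * (M * (M * (M * (M + 2 * M)))))
      (Cmod (w - z) * Cmod (w - z))).
    * repeat (first [apply Cmod_mult_le | apply Cmod_plus_le]; try eassumption).
    * rewrite Cmod_mult; apply Rle_refl.
  + replace (1 * (1 * 1) * (M * (M * (M * (M + 2 * M)))) *
             (Cmod (w - z) * Cmod (w - z)))
      with (3 * M ^ 4 * Cmod (w - z) ^ 2) by ring.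
    apply Rmult_le_compat_r; [apply pow2_ge_0 |]; nra.
- replace (2 * (b n * b n * (/ (1 - b n * w) * (/ (1 - b n * w) * / (1 - b n * w)))) -
           2 * (b n * b n * (/ (1 - b n * z) * (/ (1 - b n * z) * / (1 - b n * z)))))%C
    with (2 * (b n * (b n * b n)) * (/ (1 - b n * z) * (/ (1 - b n * w) *
           (/ (1 - b n * w) * / (1 - b n * w) + (/ (1 - b n * w) * / (1 - b n * z) +
            / (1 - b n * z) * / (1 - b n * z))))) * (w - z))%C
    by (field; split; assumption).
  eapply Rle_trans.
  + apply (Cmod_mult_le _ _ (2 * (1 * (1 * 1)) * (M * (M * (M * M + (M * M + M * M))))));
      [| apply Rle_refl].
    repeat (first [apply Cmod_mult_le | apply Cmod_plus_le]; try eassumption).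
  + replace (2 * (1 * (1 * 1)) * (M * (M * (M * M + (M * M + M * M))))) with (6 * M ^ 4)
      by ring.
    lra.
Qed.

Lemma C1_plus_const (f f1 f2 : R -> R -> R) (a x y : R) :
  C1_at f f1 f2 x y -> C1_at (fun u v => f u v + a) f1 f2 x y.
Proof.
intros [h1 [h2 [h3 h4]]]; split; [| split; [| split]]; auto.
- rewrite <- (Rplus_0_r (f1 x y)).
  exact (is_derive_plus (V := R_NormedModule) _ _ _ _ _ h1 (is_derive_const a x)).
- rewrite <- (Rplus_0_r (f2 x y)).
  exact (is_derive_plus (V := R_NormedModule) _ _ _ _ _ h2 (is_derive_const a y)).
Qed.

(* [2 Re (1 / (1 - b z)) - 1] is the Poisson kernel with pole [Cconj b]. *)
Lemma Har_plus_poisson_series (w : nat -> R) (b : nat -> C) (s : R) :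
  (forall n, 0 <= w n) -> ex_series w -> (forall n, Cmod (b n) <= 1) ->
  (forall z, Defs.disc z -> 0 < wsum w (fun n => Re (2 * / (1 - b n * z))%C) + s) ->
  Har_plus (fun z => wsum w (fun n => Re (2 * / (1 - b n * z))%C) + s).
Proof.
intros hw sw hb pos; split; [| exact pos].
pose proof (taylor_family_kernel1 b hb) as t1.
pose proof (taylor_family_kernel2 b hb) as t2.
eapply C2_harmonic_disc.
- intros u v d.
  apply (C1_plus_const
    (fun x y => wsum w (fun n => Re (2 * / (1 - b n * (x, y)))%C))).
  exact (wsum_C1 w _ _ 2 u v hw sw t1 d).
- intros u v d; exact (wsum_C1 w _ _ 2 u v hw sw t2 d).
- intros u v d; exact (wsum_C1 w _ _ (2 * Ci) u v hw sw t2 d).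
(* With [g''] the second complex derivative of a term, the two pure second partial derivatives are
   [Re (2 g'')] and [Re (2 i i g'')], which cancel term by term. *)
- intros u v d; cbv beta; unfold wsum.
  match goal with |- Series ?a + Series ?c = 0 =>
    replace (Series c) with (- Series a) end; [ring |].
  rewrite <- Series_opp; apply Series_ext; intros n.
  generalize (2 * (b n * b n * (/ (1 - b n * (u, v)) *
    (/ (1 - b n * (u, v)) * / (1 - b n * (u, v))))))%C.
  intros X; unfold Re, Cmult, Ci; simpl; ring.
Qed.

(** * Blaschke products *)

Lemma disc_sub_neq_0 (a z : C) :
  Defs.disc a -> Defs.disc z -> (1 - Cconj a * z <> 0)%C.
Proof.
intros ha hz; apply (Cmod_sub_ge (Cconj a) z (1 - Cmod z)).
- rewrite Cmod_conj; left; exact ha.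
- lra.
- unfold Defs.disc in hz; lra.
Qed.

Lemma Cmod_disc_sub_ge (a z : C) :
  Defs.disc a -> Defs.disc z ->
  1 - Cmod z <= Cmod (1 - Cconj a * z) /\ 1 - Cmod a <= Cmod (1 - Cconj a * z).
Proof.
unfold Defs.disc; intros ha hz; split.
- apply (Cmod_sub_ge (Cconj a) z (1 - Cmod z)); [rewrite Cmod_conj; lra | lra | lra].
- rewrite Cmult_comm.
  apply (Cmod_sub_ge z (Cconj a) (1 - Cmod a)); [lra | rewrite Cmod_conj; lra | lra].
Qed.

Lemma rho_eq (z a : C) :
  Defs.disc a -> Defs.disc z -> rho z a = Cmod (z - a) / Cmod (1 - Cconj a * z).
Proof. intros ha hz; apply Cmod_div; apply disc_sub_neq_0; assumption. Qed.

Lemma Cmod_blaschke_identity (z a : C) :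
  Cmod (1 - Cconj a * z) ^ 2 - Cmod (z - a) ^ 2 = (1 - Cmod a ^ 2) * (1 - Cmod z ^ 2).
Proof.
rewrite !Cmod2_alt; destruct z as [x y]; destruct a as [u v].
unfold Re, Im, Cconj, Cminus, Cplus, Copp, Cmult, RtoC; simpl; ring.
Qed.

Lemma one_minus_rho_sqr (z a : C) :
  Defs.disc a -> Defs.disc z ->
  1 - rho z a ^ 2 =
  (1 - Cmod a ^ 2) * (1 - Cmod z ^ 2) / Cmod (1 - Cconj a * z) ^ 2.
Proof.
intros ha hz; rewrite <- Cmod_blaschke_identity, rho_eq by assumption.
field; apply Rgt_not_eq, Cmod_gt_0; apply disc_sub_neq_0; assumption.
Qed.

Lemma rho_le_1 (z a : C) : Defs.disc a -> Defs.disc z -> 0 <= rho z a <= 1.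
Proof.
intros ha hz; split; [apply Cmod_ge_0 |].
assert (h := one_minus_rho_sqr z a ha hz).
assert (0 <= 1 - rho z a ^ 2).
{ rewrite h; unfold Defs.disc in *.
  assert (p : 0 < Cmod (1 - Cconj a * z)) by (apply Cmod_gt_0; apply disc_sub_neq_0; auto).
  pose proof (Cmod_ge_0 a); pose proof (Cmod_ge_0 z).
  unfold Rdiv; apply Rmult_le_pos; [apply Rmult_le_pos; nra |].
  left; apply Rinv_0_lt_compat; nra. }
assert (0 <= rho z a) by apply Cmod_ge_0; nra.
Qed.

Lemma Cmod_blaschke_factor (a z : C) :
  Defs.disc a -> Defs.disc z -> Cmod (blaschke_factor a z) = rho z a.
Proof.
intros ha hz; unfold blaschke_factor, rho.
destruct (Ceq_dec a 0) as [-> | na].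
- f_equal.
  replace (Cconj 0) with (RtoC 0) by (unfold Cconj, RtoC; simpl; f_equal; ring).
  replace (1 - 0 * z)%C with (RtoC 1) by ring; field.
- assert (n1 := disc_sub_neq_0 a z ha hz).
  rewrite Cmod_mult, !Cmod_div by assumption.
  rewrite Cmod_R, (Rabs_pos_eq (Cmod a)) by apply Cmod_ge_0.
  replace (a - z)%C with (- (z - a))%C by ring; rewrite Cmod_opp.
  field; split; apply Rgt_not_eq, Cmod_gt_0; assumption.
Qed.

Lemma poisson_kernel (b z : C) :
  Cmod b = 1 -> Defs.disc z ->
  2 * Re (/ (1 - b * z)) - 1 = (1 - Cmod z ^ 2) / Cmod (1 - b * z) ^ 2.
Proof.
intros hb hz.
assert (n : (1 - b * z <> 0)%C).
{ apply (Cmod_sub_ge b z (1 - Cmod z)); [lra | lra |]; unfold Defs.disc in hz; lra. }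
apply Cmod_gt_0 in n.
assert (e : Re (/ (1 - b * z)) = Re (1 - b * z) / Cmod (1 - b * z) ^ 2).
{ rewrite Cmod2_alt; destruct z as [x y]; destruct b as [u v].
  unfold Re, Im, Cinv, Cminus, Cplus, Copp, Cmult, RtoC; simpl; reflexivity. }
rewrite e.
assert (k : 1 - Cmod z ^ 2 = 2 * Re (1 - b * z) - Cmod (1 - b * z) ^ 2).
{ assert (hb2 : Cmod b ^ 2 = 1) by (rewrite hb; ring).
  replace (Cmod z ^ 2) with (Cmod b ^ 2 * Cmod z ^ 2) by (rewrite hb2; ring).
  rewrite !Cmod2_alt; destruct z as [x y]; destruct b as [u v].
  unfold Re, Im, Cminus, Cplus, Copp, Cmult, RtoC; simpl; ring. }
rewrite k; field; lra.
Qed.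

(** Since [|b - Cconj a| = 1 - |a| <= |1 - Cconj a * z|], moving the pole to the circle at most
    doubles the denominator, which costs 4 after squaring; [1 - |a|^2 <= 2 (1 - |a|)] gives the
    remaining 2. Written as [Cconj a = Cmod a * b], the relation between [a] and [b] also covers
    [a = 0]. *)
Lemma one_minus_rho_sqr_le_poisson (a b z : C) :
  Defs.disc a -> Defs.disc z -> Cmod b = 1 -> Cconj a = (Cmod a * b)%C ->
  1 - rho z a ^ 2 <= 8 * (1 - Cmod a) * (2 * Re (/ (1 - b * z)) - 1).
Proof.
intros ha hz hb hab.
rewrite one_minus_rho_sqr, poisson_kernel by assumption.
destruct (Cmod_disc_sub_ge a z ha hz) as [_ h].
assert (p1 : 0 < Cmod (1 - Cconj a * z)) by (apply Cmod_gt_0; apply disc_sub_neq_0; auto).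
assert (n : (1 - b * z <> 0)%C).
{ apply (Cmod_sub_ge b z (1 - Cmod z)); [lra | lra |]; unfold Defs.disc in hz; lra. }
apply Cmod_gt_0 in n.
assert (t : Cmod (1 - b * z) <= 2 * Cmod (1 - Cconj a * z)).
{ replace (1 - b * z)%C with ((1 - Cconj a * z) + - ((RtoC (1 - Cmod a)) * (b * z)))%C.
  2:{ rewrite hab, RtoC_minus; ring. }
  eapply Rle_trans; [apply Cmod_triangle |].
  rewrite Cmod_opp, !Cmod_mult, hb, Cmod_R.
  unfold Defs.disc in *; rewrite Rabs_pos_eq by lra.
  pose proof (Cmod_ge_0 z); nra. }
unfold Defs.disc in *.
pose proof (Cmod_ge_0 z); pose proof (Cmod_ge_0 a).
set (X := Cmod (1 - b * z)) in *; set (Y := Cmod (1 - Cconj a * z)) in *.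
assert (i : / Y ^ 2 <= 4 * / X ^ 2).
{ replace (4 * / X ^ 2) with (/ ((X / 2) ^ 2)) by (field; lra).
  apply Rinv_le_contravar; [nra |]; nra. }
assert (iY : 0 < / Y ^ 2) by (apply Rinv_0_lt_compat; nra).
assert (hz2 : 0 <= 1 - Cmod z ^ 2) by (clearbody X Y; clear - hz H; nra).
assert (ha2 : 1 - Cmod a ^ 2 <= 2 * (1 - Cmod a)) by
  (pose proof (pow2_ge_0 (1 - Cmod a)); lra).
unfold Rdiv.
apply Rle_trans with ((2 * (1 - Cmod a)) * (1 - Cmod z ^ 2) * / Y ^ 2).
- apply Rmult_le_compat_r; [lra |]; apply Rmult_le_compat_r; assumption.
- replace (8 * (1 - Cmod a) * ((1 - Cmod z ^ 2) * / X ^ 2))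
    with ((2 * (1 - Cmod a)) * (1 - Cmod z ^ 2) * (4 * / X ^ 2)) by ring.
  apply Rmult_le_compat_l; [| exact i].
  apply Rmult_le_pos; [lra | exact hz2].
Qed.

(** * The Poisson majorant of the sums of [1 - rho z a ^ 2] *)

Definition zeros_in_disc (L : zero_seq) : Prop :=
  forall (n : nat) (a : C), L n = Some a -> Defs.disc a.

Definition zero_weight (L : zero_seq) (n : nat) : R :=
  match L n with Some a => 1 - Cmod a | None => 0 end.

(** The conjugate of [a / |a|], because the kernel with parameter [b] has its pole at [Cconj b]. A
    zero at the origin has no direction and receives 1. *)
Definition zero_direction (L : zero_seq) (n : nat) : C :=
  match L n with
  | Some a => if Ceq_dec a 0 then 1%C else (Cconj a / Cmod a)%C
  | None => 1%C
  end.

(** With the value 1, an index that carries no point contributes nothing to the product, to the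
    logarithms or to the sum of [1 - rho ^ 2]. *)
Definition zero_dist (L : zero_seq) (z : C) (n : nat) : R :=
  match L n with Some a => rho z a | None => 1 end.

Lemma Cmod_zero_direction (L : zero_seq) (n : nat) : Cmod (zero_direction L n) = 1.
Proof.
unfold zero_direction; destruct (L n) as [a |]; [| apply Cmod_1].
destruct (Ceq_dec a 0) as [e | na]; [apply Cmod_1 |].
apply Cmod_gt_0 in na.
rewrite Cmod_div, Cmod_conj, Cmod_R, Rabs_pos_eq by (try (intros e; apply RtoC_inj in e); lra).
field; lra.
Qed.

Lemma zero_dist_poisson (L : zero_seq) (z : C) (n : nat) :
  zeros_in_disc L -> Defs.disc z ->
  1 - zero_dist L z n ^ 2 <=
  8 * zero_weight L n * (2 * Re (/ (1 - zero_direction L n * z)) - 1).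
Proof.
intros hL hz; pose proof (Cmod_zero_direction L n) as h1; revert h1.
unfold zero_dist, zero_weight, zero_direction.
destruct (L n) as [a |] eqn:e; [| intros _; lra].
intros h1; apply one_minus_rho_sqr_le_poisson; eauto.
destruct (Ceq_dec a 0) as [-> | na].
- rewrite Cmod_0; unfold Cconj, Cmult, RtoC; simpl; f_equal; ring.
- field; intros h; apply RtoC_inj in h; apply Cmod_eq_0 in h; auto.
Qed.

(** This is 1 plus the sum of [8 (1 - |a|)] times the Poisson kernels at [a / |a|], with the
    constant terms of the kernels collected in one series. The added 1 keeps the function positive
    when there are no zeros. *)
Definition zero_majorant (L : zero_seq) (z : C) : R :=
  wsum (fun n => 8 * zero_weight L n) (fun n => Re (2 * / (1 - zero_direction L n * z))%C) +
  (1 - Series (fun n => 8 * zero_weight L n)).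

Lemma zero_weight_nonneg (L : zero_seq) (n : nat) :
  zeros_in_disc L -> 0 <= zero_weight L n.
Proof.
intros hL; unfold zero_weight; destruct (L n) as [a |] eqn:e; [| lra].
specialize (hL n a e); unfold Defs.disc in hL; lra.
Qed.

Lemma zero_majorant_eq (L : zero_seq) (z : C) :
  zeros_in_disc L -> ex_series (zero_weight L) -> Defs.disc z ->
  is_series (fun n => 8 * zero_weight L n *
      (2 * Re (/ (1 - zero_direction L n * z)) - 1)) (zero_majorant L z - 1).
Proof.
intros hL sL hz.
set (w := fun n => 8 * zero_weight L n).
assert (hw : forall n, 0 <= w n).
{ intros n; pose proof (zero_weight_nonneg L n hL); unfold w; lra. }
assert (sw : ex_series w) by (apply (ex_series_scal_l (V := R_NormedModule)); exact sL).
set (c := fun n => Re (2 * / (1 - zero_direction L n * z))%C).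
assert (bc : bounded_seq c).
{ exists (Cmod 2 * / (1 - Cmod z)); intros n; apply Re_mult_le.
  unfold Defs.disc in hz.
  destruct (Cmod_sub_ge (zero_direction L n) z (1 - Cmod z)) as [h h'];
    [rewrite Cmod_zero_direction; lra | lra | lra |].
  rewrite Cmod_inv by exact h'; apply Rinv_le_contravar; lra. }
assert (s := is_series_minus (V := R_NormedModule) _ _ _ _
  (Series_correct _ (ex_wsum w c hw sw bc)) (Series_correct _ sw)).
replace (zero_majorant L z - 1) with (minus (Series (fun n => w n * c n)) (Series w)).
2:{ transitivity ((Series (fun n => w n * c n) + (1 - Series w)) - 1); [| reflexivity].
    unfold minus, plus, opp; simpl; ring. }
revert s; apply is_series_ext; intros n.
unfold c, w, minus, plus, opp; simpl.
generalize (/ (1 - zero_direction L n * z))%C; intros X.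
unfold Re, Cmult, RtoC; simpl; ring.
Qed.

Lemma poisson_kernel_nonneg (L : zero_seq) (z : C) (n : nat) :
  zeros_in_disc L -> Defs.disc z ->
  0 <= 8 * zero_weight L n * (2 * Re (/ (1 - zero_direction L n * z)) - 1).
Proof.
intros hL hz; pose proof (zero_weight_nonneg L n hL) as hw.
rewrite poisson_kernel by (try apply Cmod_zero_direction; exact hz).
apply Rmult_le_pos; [lra |].
unfold Defs.disc in hz; pose proof (Cmod_ge_0 z).
unfold Rdiv; apply Rmult_le_pos; [nra |].
left; apply Rinv_0_lt_compat; apply pow_lt; apply Cmod_gt_0.
apply (Cmod_sub_ge _ z (1 - Cmod z)); [rewrite Cmod_zero_direction; lra | lra | lra].
Qed.

Lemma zero_majorant_ge_1 (L : zero_seq) (z : C) :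
  zeros_in_disc L -> ex_series (zero_weight L) -> Defs.disc z -> 1 <= zero_majorant L z.
Proof.
intros hL sL hz.
assert (s := zero_majorant_eq L z hL sL hz).
rewrite <- (Rplus_0_l 1); apply Rplus_le_reg_r with (- 1).
replace (0 + 1 + -1) with (Series (fun _ : nat => 0 * 0)).
2:{ rewrite Series_scal_l; ring. }
replace (zero_majorant L z + -1) with (zero_majorant L z - 1) by ring.
rewrite <- (is_series_unique _ _ s).
apply Series_le; [| eexists; exact s].
intros n; pose proof (poisson_kernel_nonneg L z n hL hz); lra.
Qed.

Lemma Har_plus_zero_majorant (L : zero_seq) :
  zeros_in_disc L -> ex_series (zero_weight L) -> Har_plus (zero_majorant L).
Proof.
intros hL sL; apply Har_plus_poisson_series.
- intros n; pose proof (zero_weight_nonneg L n hL); lra.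
- apply (ex_series_scal_l (V := R_NormedModule)); exact sL.
- intros n; rewrite Cmod_zero_direction; lra.
- intros z hz; pose proof (zero_majorant_ge_1 L z hL sL hz) as h.
  unfold zero_majorant in h; lra.
Qed.

Fixpoint zero_defect (L : zero_seq) (z : C) (n : nat) : R :=
  match n with O => 0 | S m => zero_defect L z m + (1 - zero_dist L z m ^ 2) end.

Lemma zero_defect_le (L : zero_seq) (z : C) (N : nat) :
  zeros_in_disc L -> ex_series (zero_weight L) -> Defs.disc z ->
  zero_defect L z N <= zero_majorant L z.
Proof.
intros hL sL hz.
assert (s := zero_majorant_eq L z hL sL hz).
set (t := fun n => 8 * zero_weight L n *
      (2 * Re (/ (1 - zero_direction L n * z)) - 1)) in *.
assert (ht : forall n, 0 <= t n) by (intros n; apply poisson_kernel_nonneg; auto).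
(* [sum_n t n] includes the index [n], while [zero_defect] stops before its argument; hence
   [S n]. *)
assert (b : forall n, zero_defect L z (S n) <= sum_n t n).
{ induction n as [| n IH].
  - simpl; rewrite sum_O; pose proof (zero_dist_poisson L z 0 hL hz) as h.
    fold (t 0%nat) in h; simpl zero_defect; lra.
  - rewrite sum_Sn; change (zero_defect L z (S n) + (1 - zero_dist L z (S n) ^ 2) <=
      sum_n t n + t (S n)).
    pose proof (zero_dist_poisson L z (S n) hL hz) as h; fold (t (S n)) in h; lra. }
assert (c : forall n, sum_n t n <= zero_majorant L z - 1).
{ intros n; apply (is_lim_seq_incr_compare (sum_n t)); [exact s |].
  intros k; rewrite sum_Sn; unfold plus; simpl; specialize (ht (S k)); lra. }
destruct N as [| N].
- simpl; pose proof (zero_majorant_ge_1 L z hL sL hz); lra.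
- specialize (b N); specialize (c N); lra.
Qed.

(** * Logarithms of the partial products and of their limit *)

Lemma Cmod_blaschke_partial_S (L : zero_seq) (z : C) (n : nat) :
  zeros_in_disc L -> Defs.disc z ->
  Cmod (blaschke_partial L (S n) z) = Cmod (blaschke_partial L n z) * zero_dist L z n.
Proof.
intros hL hz; simpl; rewrite Cmod_mult; f_equal; unfold zero_dist.
destruct (L n) as [a |] eqn:e; [| apply Cmod_1].
apply Cmod_blaschke_factor; eauto.
Qed.

Definition neg_log_partial (L : zero_seq) (z : C) (n : nat) : R :=
  - ln (Cmod (blaschke_partial L n z)).

Lemma neg_log_partial_S (L : zero_seq) (z : C) (n : nat) :
  zeros_in_disc L -> Defs.disc z -> (forall n, 0 < zero_dist L z n) ->
  0 < Cmod (blaschke_partial L n z) /\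
  neg_log_partial L z (S n) = neg_log_partial L z n + - ln (zero_dist L z n).
Proof.
intros hL hz pos.
assert (p : 0 < Cmod (blaschke_partial L n z)).
{ induction n as [| n IH]; [simpl; rewrite Cmod_1; lra |].
  rewrite Cmod_blaschke_partial_S by assumption; apply Rmult_lt_0_compat; auto. }
split; [exact p |]; unfold neg_log_partial.
rewrite Cmod_blaschke_partial_S, ln_mult by auto; ring.
Qed.

Lemma neg_log_partial_compare (L : zero_seq) (z z' : C) (A K : R) (N : nat) :
  zeros_in_disc L -> Defs.disc z -> Defs.disc z' ->
  (forall n, 0 < zero_dist L z n) -> (forall n, 0 < zero_dist L z' n) ->
  (forall n, - ln (zero_dist L z n) <=
     A * - ln (zero_dist L z' n) + K * (1 - zero_dist L z n ^ 2)) ->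
  neg_log_partial L z N <= A * neg_log_partial L z' N + K * zero_defect L z N.
Proof.
intros hL hz hz' p p' h; induction N as [| N IH].
- unfold neg_log_partial; simpl; rewrite Cmod_1, ln_1; lra.
- destruct (neg_log_partial_S L z N hL hz p) as [_ ->].
  destruct (neg_log_partial_S L z' N hL hz' p') as [_ ->].
  simpl zero_defect; specialize (h N); lra.
Qed.

Lemma Cmod_triang_inv (u v : C) : Rabs (Cmod u - Cmod v) <= Cmod (u - v).
Proof.
apply Rabs_le; split.
- assert (t := Cmod_triangle u (- (u - v))).
  replace (u + - (u - v))%C with v in t by ring; rewrite Cmod_opp in t; lra.
- assert (t := Cmod_triangle v (u - v)).
  replace (v + (u - v))%C with u in t by ring; lra.
Qed.

Lemma is_lim_seq_Cmod_blaschke (L : zero_seq) (B : C -> C) (z : C) :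
  is_blaschke_product L B -> Defs.disc z ->
  is_lim_seq (fun n => Cmod (blaschke_partial L n z)) (Cmod (B z)).
Proof.
intros [_ [_ [c [hc h]]]] hz; specialize (h z hz).
assert (e : filterlim (fun n => Cmod (c * blaschke_partial L n z)) eventually
  (locally (Cmod (B z)))).
{ apply filterlim_locally; intros eps.
  assert (he : 0 < eps / 2) by (pose proof (cond_pos eps); lra).
  assert (h' := proj1 (filterlim_locally _ _) h (mkposreal _ he)).
  revert h'; apply filter_imp; intros n [b1 b2].
  revert b1 b2; generalize (c * blaschke_partial L n z)%C; intros u b1 b2.
  change (Rabs (Cmod u - Cmod (B z)) < eps).
  destruct u as [u1 u2]; destruct (B z) as [v1 v2].
  assert (b := Cmod_box u1 u2 v1 v2 eps b1 b2).
  eapply Rle_lt_trans; [| exact b].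
  apply Cmod_triang_inv. }
revert e; apply filterlim_ext; intros n; rewrite Cmod_mult, hc; ring.
Qed.

Lemma exp_monotone (x y : R) : x <= y -> exp x <= exp y.
Proof.
intros [h | ->]; [left; apply exp_increasing; exact h | apply Rle_refl].
Qed.

(** The bound passes to the limit as [exp (- T) <= Cmod (B z)], before any logarithm of the limit is
    taken; this also shows that [B z] is not 0. *)
Lemma neg_log_le_limit (L : zero_seq) (B : C -> C) (z : C) (T : R) :
  is_blaschke_product L B -> Defs.disc z -> (forall n, 0 < zero_dist L z n) ->
  (forall n, neg_log_partial L z n <= T) -> 0 < Cmod (B z) /\ neg_log_mod B z <= T.
Proof.
intros hB hz pos h.
assert (l := is_lim_seq_Cmod_blaschke L B z hB hz).
assert (b : exp (- T) <= Cmod (B z)).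
{ apply (is_lim_seq_le (fun _ => exp (- T)) (fun n => Cmod (blaschke_partial L n z))
    (exp (- T)) (Cmod (B z))); [| apply is_lim_seq_const | exact l].
  intros n; destruct (neg_log_partial_S L z n (proj1 hB) hz pos) as [p _].
  rewrite <- (exp_ln _ p); specialize (h n); unfold neg_log_partial in h.
  apply exp_monotone; lra. }
pose proof (exp_pos (- T)) as ep; split; [lra |].
unfold neg_log_mod; rewrite <- (Ropp_involutive T), <- (ln_exp (- T)).
apply Ropp_le_contravar; apply ln_le; assumption.
Qed.

(** From [ln (/ x) <= / x - 1]; the rest is [c (1 - x) <= x (1 + x) (1 - x)]. *)
Lemma neg_ln_le (x c : R) : 0 < c -> c <= x <= 1 -> - ln x <= / c * (1 - x ^ 2).
Proof.
intros hc hx.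
assert (e : - ln x <= / x - 1).
{ rewrite <- ln_Rinv by lra.
  assert (ip : 0 < / x) by (apply Rinv_0_lt_compat; lra).
  pose proof (exp_ineq1_le (ln (/ x))) as q; rewrite exp_ln in q by exact ip; lra. }
eapply Rle_trans; [exact e |].
apply (Rmult_le_reg_l (c * x)); [nra |].
replace (c * x * (/ x - 1)) with (c * (1 - x)) by (field; lra).
replace (c * x * (/ c * (1 - x ^ 2))) with (x * (1 + x) * (1 - x)) by (field; lra).
apply Rmult_le_compat_r; nra.
Qed.

(** It has two uses: with [c] independent of [z] it provides the majorant where [H] is bounded, and
    with [c] depending on [z] it shows that [B z] is not 0. *)
Lemma neg_log_mod_away (L : zero_seq) (B : C -> C) (z : C) (c : R) :
  is_blaschke_product L B -> Defs.disc z -> 0 < c ->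
  (forall n, c <= zero_dist L z n) ->
  0 < Cmod (B z) /\ neg_log_mod B z <= / c * zero_majorant L z.
Proof.
intros hB hz hc h; pose proof hB as [hL [sL _]].
assert (pos : forall n, 0 < zero_dist L z n) by (intros n; specialize (h n); lra).
assert (ic : 0 < / c) by (apply Rinv_0_lt_compat; exact hc).
apply (neg_log_le_limit L B z); auto; intros N.
eapply Rle_trans.
(* With [A = 0] there is no reference point, and [z] itself fills its place. *)
- apply (neg_log_partial_compare L z z 0 (/ c)); auto.
  intros n; rewrite Rmult_0_l, Rplus_0_l; apply neg_ln_le; [exact hc |].
  split; [apply h |]; unfold zero_dist; destruct (L n) as [a |] eqn:e; [| lra].
  apply rho_le_1; eauto.
- rewrite Rmult_0_l, Rplus_0_l; apply Rmult_le_compat_l; [lra |].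
  apply zero_defect_le; auto.
Qed.

(** The bounds [c] and [c'] guarantee that [B] vanishes at neither point, so that [ln] is continuous
    at both limits. They do not enter the estimate and may depend on the points. *)
Lemma neg_log_mod_compare (L : zero_seq) (B : C -> C) (z z' : C) (A K c c' : R) :
  is_blaschke_product L B -> Defs.disc z -> Defs.disc z' -> 0 <= K ->
  0 < c -> (forall n, c <= zero_dist L z n) ->
  0 < c' -> (forall n, c' <= zero_dist L z' n) ->
  (forall n, - ln (zero_dist L z n) <=
     A * - ln (zero_dist L z' n) + K * (1 - zero_dist L z n ^ 2)) ->
  neg_log_mod B z <= A * neg_log_mod B z' + K * zero_majorant L z.
Proof.
intros hB hz hz' hK hc h hc' h' cmp; pose proof hB as [hL [sL _]].
assert (lim : forall y, Defs.disc y -> 0 < Cmod (B y) ->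
  is_lim_seq (neg_log_partial L y) (neg_log_mod B y)).
{ intros y hy py; apply (is_lim_seq_opp _ (ln (Cmod (B y)))).
  apply (is_lim_seq_continuous ln); [| apply is_lim_seq_Cmod_blaschke; auto].
  apply derivable_continuous_pt; exists (/ Cmod (B y)).
  apply derivable_pt_lim_ln; exact py. }
destruct (neg_log_mod_away L B z c) as [p _]; auto.
destruct (neg_log_mod_away L B z' c') as [p' _]; auto.
apply (is_lim_seq_le (neg_log_partial L z)
  (fun n => A * neg_log_partial L z' n + K * zero_majorant L z)
  (neg_log_mod B z) (A * neg_log_mod B z' + K * zero_majorant L z)).
- intros N; eapply Rle_trans.
  + apply (neg_log_partial_compare L z z' A K); auto.
    * intros n; specialize (h n); lra.
    * intros n; specialize (h' n); lra.
  + apply Rplus_le_compat_l, Rmult_le_compat_l; [exact hK |].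
    apply zero_defect_le; auto.
- apply lim; auto.
- apply is_lim_seq_plus'; [| apply is_lim_seq_const].
  apply (is_lim_seq_scal_l _ A (neg_log_mod B z')); apply lim; auto.
Qed.

Lemma far_from_iff (L : zero_seq) (t : C -> R) (z : C) :
  far_from L t z <->
  Defs.disc z /\ forall n a, L n = Some a -> exp (- t z) <= rho z a.
Proof.
unfold far_from, rho_seq; split; intros [hz h]; split; auto.
- intros n a e; destruct (Glb_Rbar_correct
    (fun r => exists n a, L n = Some a /\ r = rho z a)) as [lb _].
  apply (Rbar_le_trans (exp (- t z)) _ (rho z a) h); apply lb; eauto.
- apply Glb_Rbar_correct; intros r [n [a [e ->]]]; apply (h n a e).
Qed.

(** * Whitney squares *)

Definition polar (r t : R) : C := (r * cos t, r * sin t).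

Lemma Cmod_polar (r t : R) : 0 <= r -> Cmod (polar r t) = r.
Proof.
intros hr; unfold polar; rewrite Cmod_pair.
replace ((r * cos t) ^ 2 + (r * sin t) ^ 2) with (r ^ 2).
- apply sqrt_pow2; exact hr.
- pose proof (sin2_cos2 t) as e; unfold Rsqr in e.
  replace ((r * cos t) ^ 2 + (r * sin t) ^ 2)
    with (r ^ 2 * (sin t * sin t + cos t * cos t)) by ring.
  rewrite e; ring.
Qed.

Lemma polar_exists (z : C) :
  z <> RtoC 0 -> exists t, 0 <= t < 2 * PI /\ z = polar (Cmod z) t.
Proof.
intros nz; apply Cmod_gt_0 in nz.
set (r := Cmod z) in *.
assert (hr : r ^ 2 = fst z ^ 2 + snd z ^ 2) by (unfold r; rewrite Cmod2_alt; reflexivity).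
set (u := fst z / r); set (v := snd z / r).
assert (huv : u ^ 2 + v ^ 2 = 1).
{ unfold u, v; transitivity ((fst z ^ 2 + snd z ^ 2) / r ^ 2); [field; lra |].
  rewrite <- hr; field; lra. }
assert (ez : z = (r * u, r * v)).
{ destruct z as [x y]; simpl in *; unfold u, v; f_equal; field; lra. }
assert (hu : -1 <= u <= 1) by (split; nra).
pose proof (acos_bound u) as ab; pose proof PI_RGT_0.
assert (sa : sin (acos u) = Rabs v).
{ rewrite sin_acos by exact hu; rewrite <- sqrt_Rsqr_abs; f_equal; unfold Rsqr; lra. }
destruct (Rle_dec 0 v) as [hv | hv].
- exists (acos u); split; [lra |].
  rewrite ez; unfold polar.
  rewrite cos_acos, sa, Rabs_pos_eq by assumption; reflexivity.
- exists (2 * PI - acos u); split.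
  + split; [lra |].
    (* Here [v < 0], so [acos u = 0] is impossible and the angle stays strictly below [2 PI]. *)
    destruct (proj1 ab) as [h | h]; [lra |].
    exfalso; rewrite <- h, sin_0 in sa.
    rewrite Rabs_left in sa by lra; lra.
  + rewrite ez; unfold polar.
    rewrite cos_minus, sin_minus, cos_2PI, sin_2PI, cos_acos, sa, Rabs_left by lra.
    f_equal; ring.
Qed.

Lemma Rabs_atan_le (x : R) : Rabs (atan x) <= Rabs x.
Proof.
destruct (MVT_gen atan 0 x (fun c => / (1 + c ^ 2))) as [c [_ e]].
- intros s _; apply is_derive_Reals.
  apply derivable_pt_lim_atan.
- intros s _; apply derivable_continuous_pt, derivable_pt_atan.
- rewrite atan_0, !Rminus_0_r in e; rewrite e, Rabs_mult.
  pose proof (pow2_ge_0 c).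
  rewrite Rabs_inv, (Rabs_pos_eq (1 + c ^ 2)) by lra.
  rewrite <- (Rmult_1_l (Rabs x)) at 2.
  apply Rmult_le_compat_r; [apply Rabs_pos |].
  rewrite <- Rinv_1; apply Rinv_le_contravar; lra.
Qed.

Lemma Rabs_le_Cmod (x y : R) : Rabs x <= Cmod (x, y) /\ Rabs y <= Cmod (x, y).
Proof.
pose proof (Rmax_Cmod (x, y)) as h; simpl in h.
pose proof (Rmax_l (Rabs x) (Rabs y)); pose proof (Rmax_r (Rabs x) (Rabs y)); lra.
Qed.

(** A rotation by [- t] moves [polar r t] to the positive axis and [a] to [u + i v] with
    [u >= 1 / 4]; the argument then changes by [atan (v / u)], at most [4 e]. The angle [t'] is not
    reduced modulo [2 PI], so it stays near [t]. *)
Lemma polar_near (r t e : R) (a : C) :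
  1 / 2 <= r -> e <= 1 / 4 -> Cmod (a - polar r t) <= e ->
  exists t', a = polar (Cmod a) t' /\ Rabs (Cmod a - r) <= e /\ Rabs (t' - t) <= 4 * e.
Proof.
intros hr he h.
set (u := fst a * cos t + snd a * sin t); set (v := - fst a * sin t + snd a * cos t).
pose proof (sin2_cos2 t) as sc; unfold Rsqr in sc.
assert (m : Cmod (u - r, v) = Cmod (a - polar r t)).
{ rewrite Cmod_pair; unfold Cmod; f_equal; destruct a as [x y].
  unfold u, v, polar; simpl.
  replace (sin t * sin t) with (1 - cos t * cos t) by lra.
  transitivity ((x ^ 2 + y ^ 2) * (sin t * sin t + cos t * cos t) +
    r ^ 2 - 2 * r * (x * cos t + y * sin t)); [ring |].
  transitivity ((x ^ 2 + y ^ 2) + r ^ 2 * (sin t * sin t + cos t * cos t) -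
    2 * r * (x * cos t + y * sin t)); [rewrite sc; ring | ring]. }
destruct (Rabs_le_Cmod (u - r) v) as [bu bv]; rewrite m in bu, bv.
assert (hu : 1 / 4 <= u) by (apply Rabs_le_between in bu; try lra).
assert (eqm : Cmod a = u * sqrt (1 + (v / u) ^ 2)).
{ assert (e0 : 0 <= 1 + (v / u) ^ 2) by (pose proof (pow2_ge_0 (v / u)); lra).
  rewrite <- (sqrt_pow2 u) at 1 by lra.
  rewrite <- sqrt_mult by (try apply pow2_ge_0; exact e0).
  unfold Cmod; f_equal.
  transitivity ((fst a ^ 2 + snd a ^ 2) * (sin t * sin t + cos t * cos t));
    [rewrite sc; ring |].
  transitivity (u ^ 2 + v ^ 2); [unfold u, v; ring | field; lra]. }
assert (sp : 0 < sqrt (1 + (v / u) ^ 2))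
  by (apply sqrt_lt_R0; pose proof (pow2_ge_0 (v / u)); lra).
exists (t + atan (v / u)); split; [| split].
- unfold polar; rewrite cos_plus, sin_plus, cos_atan, sin_atan.
  replace (Rsqr (v / u)) with ((v / u) ^ 2) by (unfold Rsqr; ring).
  rewrite eqm; destruct a as [x y]; unfold u, v in *; simpl in *.
  f_equal.
  + transitivity (x * (sin t * sin t + cos t * cos t)); [rewrite sc; ring |].
    field; split; lra.
  + transitivity (y * (sin t * sin t + cos t * cos t)); [rewrite sc; ring |].
    field; split; lra.
- rewrite <- (Cmod_polar r t) at 1 by lra.
  eapply Rle_trans; [apply Cmod_triang_inv | exact h].
- replace (t + atan (v / u) - t) with (atan (v / u)) by ring.
  eapply Rle_trans; [apply Rabs_atan_le |].
  unfold Rdiv; rewrite Rabs_mult, Rabs_inv, (Rabs_pos_eq u) by lra.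
  assert (iu : / u <= 4).
  { replace 4 with (/ (1 / 4)) by field; apply Rinv_le_contravar; lra. }
  assert (0 < / u) by (apply Rinv_0_lt_compat; lra).
  pose proof (Rabs_pos v); nra.
Qed.

Lemma Rabs_sin_le (x : R) : Rabs (sin x) <= Rabs x.
Proof.
destruct (MVT_gen sin 0 x cos) as [c [_ e]].
- intros s _; apply is_derive_Reals, derivable_pt_lim_sin.
- intros s _; apply continuity_sin.
- rewrite sin_0, !Rminus_0_r in e; rewrite e, Rabs_mult.
  rewrite <- (Rmult_1_l (Rabs x)) at 2.
  apply Rmult_le_compat_r; [apply Rabs_pos |].
  apply Rabs_le, COS_bound.
Qed.

Lemma Cmod_polar_sub (r t r' t' : R) :
  0 <= r <= 1 -> Cmod (polar r t - polar r' t') <= Rabs (r - r') + Rabs (t - t').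
Proof.
intros hr.
replace (polar r t - polar r' t')%C with
  (RtoC (r - r') * polar 1 t' + RtoC r * (polar 1 t - polar 1 t'))%C.
2:{ unfold polar, RtoC, Cminus, Cplus, Copp, Cmult; simpl; f_equal; ring. }
eapply Rle_trans; [apply Cmod_triangle |].
rewrite !Cmod_mult, !Cmod_R, Cmod_polar, Rmult_1_r by lra.
apply Rplus_le_compat_l.
assert (h : Cmod (polar 1 t - polar 1 t') <= Rabs (t - t')).
{ unfold Cmod, polar; simpl.
  rewrite <- sqrt_Rsqr_abs; apply sqrt_le_1_alt.
  pose proof (sin2_cos2 t) as e1; pose proof (sin2_cos2 t') as e2; unfold Rsqr in e1, e2.
  set (d := (t - t') / 2).
  assert (c : cos (t - t') = 1 - 2 * sin d * sin d).
  { replace (t - t') with (2 * d) by (unfold d; field); apply cos_2a_sin. }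
  rewrite cos_minus in c.
  assert (s : sin d * sin d <= d * d).
  { pose proof (Rabs_sin_le d) as q; apply Rsqr_le_abs_1 in q; exact q. }
  replace (Rsqr (t - t')) with (4 * (d * d)) by (unfold d, Rsqr; field).
  nra. }
rewrite (Rabs_pos_eq r) by lra.
pose proof (Cmod_ge_0 (polar 1 t - polar 1 t')); nra.
Qed.

Lemma polar_inj (r t t' : R) :
  0 < r -> Rabs (t - t') < PI -> polar r t = polar r t' -> t = t'.
Proof.
intros hr ht e; injection e; intros e2 e1.
apply Rmult_eq_reg_l in e1; [| lra]; apply Rmult_eq_reg_l in e2; [| lra].
assert (s : sin (t - t') = 0) by (rewrite sin_minus, e1, e2; ring).
apply Rabs_def2 in ht.
destruct (Rtotal_order t t') as [h | [h | h]]; [exfalso | exact h | exfalso].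
- pose proof (sin_gt_0 (t' - t)) as q.
  replace (t' - t) with (- (t - t')) in q by ring; rewrite sin_neg, s in q; lra.
- pose proof (sin_gt_0 (t - t')) as q; rewrite s in q; lra.
Qed.

(** The points leave [x] in steps of [s] towards the farther end of the interval, where at least
    [1 / 2] is free. The first step and the spare one in [S M] keep a margin [s] at both ends, so
    that zeros near a grid point remain in the cell. *)
Lemma separated_points (x s : R) (M : nat) :
  0 <= x < 1 -> 0 < s -> INR (S M) * s <= 1 / 2 ->
  exists X : nat -> R,
    (forall i, (i < M)%nat -> s <= X i <= 1 - s /\ Rabs (X i - x) <= INR M * s) /\
    (forall i j, i <> j -> s <= Rabs (X i - X j)).
Proof.
intros hx hs hM; rewrite S_INR in hM.
assert (sep : forall i j : nat, i <> j -> 1 <= Rabs (INR i - INR j)).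
{ intros i j n; rewrite !INR_IZR_INZ, <- minus_IZR, <- abs_IZR.
  apply IZR_le; lia. }
assert (bi : forall i, (i < M)%nat -> 0 <= INR i /\ INR i + 1 <= INR M).
{ intros i h; split; [apply pos_INR |]; rewrite <- S_INR; apply le_INR; lia. }
destruct (Rle_dec x (1 / 2)) as [h | h].
- exists (fun i => x + (INR i + 1) * s); split.
  + intros i hi; destruct (bi i hi) as [b1 b2]; split; [split; nra |].
    rewrite Rabs_pos_eq; nra.
  + intros i j n; specialize (sep i j n).
    replace (x + (INR i + 1) * s - (x + (INR j + 1) * s)) with ((INR i - INR j) * s) by ring.
    rewrite Rabs_mult, (Rabs_pos_eq s) by lra; nra.
- exists (fun i => x - (INR i + 1) * s); split.
  + intros i hi; destruct (bi i hi) as [b1 b2]; split; [split; nra |].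
    rewrite Rabs_left1; nra.
  + intros i j n; specialize (sep i j n).
    replace (x - (INR i + 1) * s - (x - (INR j + 1) * s))
      with (- ((INR i - INR j) * s)) by ring.
    rewrite Rabs_Ropp, Rabs_mult, (Rabs_pos_eq s) by lra; nra.
Qed.

(** The second hypothesis makes each newly chosen index differ from those already listed, which
    yields a duplicate-free list as in [count_in]. *)
Lemma injective_choice_list (P : nat -> nat -> Prop) (N : nat) :
  (forall i, (i < N)%nat -> exists n, P i n) ->
  (forall i j n, (i < N)%nat -> (j < N)%nat -> P i n -> P j n -> i = j) ->
  exists l : list nat, NoDup l /\ length l = N /\
    forall n, In n l -> exists i, (i < N)%nat /\ P i n.
Proof.
induction N as [| N IH]; intros h inj.
- exists nil; split; [constructor | split; [reflexivity |]]; intros n [].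
- destruct IH as [l [nd [len hl]]].
  + intros i hi; apply h; lia.
  + intros i j n hi hj; apply inj; lia.
  + destruct (h N) as [n hn]; [lia |].
    exists (n :: l); split; [| split].
    * constructor; [| exact nd]; intros hin.
      destruct (hl n hin) as [i [hi hP]].
      assert (i = N) by (apply (inj i N n); auto; lia); lia.
    * simpl; rewrite len; reflexivity.
    * intros m [<- | hm]; [exists N; split; [lia | exact hn] |].
      destruct (hl m hm) as [i [hi hP]]; exists i; split; [lia | exact hP].
Qed.

(** [x] and [y] are cell coordinates, scaled to the unit square, with [x] increasing towards the
    origin. The bound on [/ 2 ^ k] keeps the radius nonnegative. *)
Lemma whitney_polar (k j : nat) (x y : R) :
  0 <= x < 1 -> 0 <= y < 1 -> / 2 ^ k <= 1 / 2 ->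
  whitney k j (polar (1 - / 2 ^ k * (1 + x)) (2 * PI * / 2 ^ k * (INR j + y))).
Proof.
intros hx hy hk; pose proof PI_RGT_0.
assert (h0 : 0 < / 2 ^ k) by (apply Rinv_0_lt_compat, pow_lt; lra).
exists (1 - / 2 ^ k * (1 + x)), (2 * PI * / 2 ^ k * (INR j + y)).
unfold Rdiv; split; [split; nra | split; [reflexivity | split; [split; nra |]]].
assert (p : 0 < 2 * PI * / 2 ^ k) by nra.
split; nra.
Qed.

(** The least [k] with [/ 2 ^ k <= d] works. As [d < 1 / 2] it is at least 2, whence the bound
    [1 / 4], which keeps the whole cell at radii above [1 / 2]. *)
Lemma dyadic_scale (d : R) : 0 < d < 1 / 2 ->
  exists k : nat, / 2 ^ k <= d < 2 / 2 ^ k /\ / 2 ^ k <= 1 / 4.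
Proof.
intros hd.
assert (E : exists n, / 2 ^ n <= d).
{ destruct (pow_lt_1_zero (/ 2) ltac:(rewrite Rabs_pos_eq; lra) d) as [n hn]; [lra |].
  exists n; specialize (hn n (le_n n)); rewrite pow_inv in hn.
  rewrite Rabs_pos_eq in hn; [lra |]; left; apply Rinv_0_lt_compat, pow_lt; lra. }
destruct E as [n hn]; induction n as [| n IH].
- simpl in hn; lra.
- destruct (Rle_dec (/ 2 ^ n) d) as [h | h]; [auto |].
  exists (S n).
  assert (e : / 2 ^ S n = / 2 * / 2 ^ n).
  { simpl; rewrite Rinv_mult; reflexivity. }
  split; [split; [exact hn |]; unfold Rdiv; rewrite e; lra |].
  destruct n as [| [| n]]; [simpl in *; lra | simpl in *; lra |].
  rewrite <- pow_inv; simpl.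
  assert (0 < (/ 2) ^ n) by (apply pow_lt; lra).
  assert ((/ 2) ^ n <= 1) by (rewrite <- (pow1 n); apply pow_incr; lra).
  lra.
Qed.

Lemma count_in_whitney (L : zero_seq) (H : C -> R) (k j : nat) (z : C) (l : list nat) :
  Rbar_le (count_in L (whitney k j)) (inf_on (whitney k j) (fun z => exp (H z))) ->
  whitney k j z -> NoDup l ->
  (forall n, In n l -> exists a : C, L n = Some a /\ whitney k j a) ->
  INR (length l) <= exp (H z).
Proof.
intros h hz nd hl.
change (Rbar_le (INR (length l)) (exp (H z))).
apply (Rbar_le_trans _ (count_in L (whitney k j))); [apply Lub_Rbar_correct; eauto |].
apply (Rbar_le_trans _ _ _ h); apply Glb_Rbar_correct; eauto.
Qed.

(** Because [1 - Cconj a * g = (1 - |g|^2) + Cconj (g - a) * g], the denominator of [rho g a] is at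
    most [4 h + |a - g|]; for [e <= 1 / 2] the second term is absorbed on the left. *)
Lemma close_of_rho (g a : C) (h e : R) :
  Defs.disc g -> Defs.disc a -> 1 - Cmod g <= 2 * h -> 0 < e <= 1 / 2 ->
  rho g a <= e -> Cmod (a - g) <= 8 * h * e.
Proof.
intros hg ha hh he hr; rewrite rho_eq in hr by assumption.
assert (p : 0 < Cmod (1 - Cconj a * g)) by (apply Cmod_gt_0; apply disc_sub_neq_0; auto).
assert (q : Cmod (g - a) <= e * Cmod (1 - Cconj a * g)).
{ apply (Rmult_le_reg_r (/ Cmod (1 - Cconj a * g))); [apply Rinv_0_lt_compat; exact p |].
  rewrite Rmult_assoc, Rinv_r, Rmult_1_r by lra; exact hr. }
assert (s : Cmod (g - a) = Cmod (a - g)).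
{ rewrite <- Cmod_opp; f_equal; ring. }
assert (t : Cmod (1 - Cconj a * g) <= 4 * h + Cmod (a - g)).
{ replace (1 - Cconj a * g)%C with (RtoC (1 - Cmod g ^ 2) + Cconj (g - a) * g)%C.
  2:{ rewrite Cmod2_alt; destruct g as [x y]; destruct a as [u v].
      unfold Re, Im, Cconj, Cminus, Cplus, Copp, Cmult, RtoC; simpl; f_equal; ring. }
  unfold Defs.disc in *; pose proof (Cmod_ge_0 g); pose proof (Cmod_ge_0 (a - g)).
  apply Cmod_plus_le.
  - rewrite Cmod_R, Rabs_pos_eq; nra.
  - rewrite Cmod_mult, Cmod_conj, s; nra. }
rewrite s in q; pose proof (Cmod_ge_0 (a - g)).
assert (hp : 0 <= h) by (unfold Defs.disc in hg; lra).
nra.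
Qed.

Lemma exists_nat_above (x : R) : 1 <= x -> exists M : nat, x < INR M <= 2 * x.
Proof.
intros hx; destruct (nfloor_ex x) as [n [h1 h2]]; [lra |].
exists (S n); rewrite S_INR; lra.
Qed.

Lemma polar_cell (z : C) :
  1 / 2 < Cmod z < 1 -> exists (k j : nat) (x y : R),
    (j < 2 ^ k)%nat /\ 0 <= x < 1 /\ 0 <= y < 1 /\
    / 2 ^ k <= 1 - Cmod z < 2 / 2 ^ k /\ / 2 ^ k <= 1 / 4 /\
    z = polar (1 - / 2 ^ k * (1 + x)) (2 * PI * / 2 ^ k * (INR j + y)).
Proof.
intros hz; pose proof PI_RGT_0 as hpi.
destruct (polar_exists z) as [t [ht ez]].
{ intros e; rewrite e, Cmod_0 in hz; lra. }
destruct (dyadic_scale (1 - Cmod z)) as [k [hk hk4]]; [lra |].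
assert (hp : 0 < 2 ^ k) by (apply pow_lt; lra).
assert (h0 : 0 < / 2 ^ k) by (apply Rinv_0_lt_compat; exact hp).
set (h := / 2 ^ k) in *.
assert (hh : h * 2 ^ k = 1) by (unfold h; field; lra).
assert (ih : / h = 2 ^ k) by (unfold h; apply Rinv_inv).
destruct (nfloor_ex (t / (2 * PI * h))) as [j [j1 j2]].
{ apply Rmult_le_pos; [lra |]; left; apply Rinv_0_lt_compat; nra. }
exists k, j, ((1 - Cmod z) / h - 1), (t / (2 * PI * h) - INR j).
assert (b1 : 1 <= (1 - Cmod z) / h < 2).
{ unfold Rdiv in *; fold h in hk; split.
  - apply (Rmult_le_reg_r h); [exact h0 |]; field_simplify; lra.
  - apply (Rmult_lt_reg_r h); [exact h0 |]; field_simplify; lra. }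
split; [| split; [lra | split; [lra | split; [exact hk | split; [exact hk4 |]]]]].
- apply INR_lt; rewrite pow_INR; simpl INR.
  eapply Rle_lt_trans; [exact j1 |].
  apply (Rmult_lt_reg_r (2 * PI * h)); [nra |].
  replace (t / (2 * PI * h) * (2 * PI * h)) with t by (field; lra).
  replace ((1 + 1) ^ k) with (2 ^ k) by (f_equal; ring); nra.
- transitivity (polar (Cmod z) t); [exact ez |].
  fold h; f_equal; field; lra.
Qed.

(* The zeros [a] with [rho z' a < exp (- H z')] for some [z'] in a grid of more
   than [exp (H z)] points with spacing [32 exp (- 3 H z / 4)] lie in the Whitney
   square of [z], and each of them excludes at most one [z']; so the
   hypothesis on [count_in] leaves a grid point that is not excluded. *)
Lemma exists_good_point (L : zero_seq) (H : C -> R) (z : C) :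
  zeros_in_disc L -> Har_plus H ->
  (forall k j : nat, (j < 2 ^ k)%nat ->
    Rbar_le (count_in L (whitney k j)) (inf_on (whitney k j) (fun z => exp (H z)))) ->
  1 / 2 < Cmod z < 1 -> 1024 * exp (- H z / 4) <= 1 / 16 ->
  exists z', Defs.disc z' /\ Cmod (z' - z) <= 1024 * exp (- H z / 4) * (1 - Cmod z) /\
    forall n a, L n = Some a -> exp (- H z') <= rho z' a.
Proof.
intros hL hH hN hz small.
apply NNPP; intros no.
destruct (polar_cell z hz) as [k [j [x [y [hj [hx [hy [hk [hk4 ez]]]]]]]]].
assert (h0 : 0 < / 2 ^ k) by (apply Rinv_0_lt_compat, pow_lt; lra).
unfold Rdiv in hk; set (h := / 2 ^ k) in *.
pose proof PI_RGT_0 as hpi; pose proof PI2_3_2 as hpi3; pose proof PI_4 as hpi4.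
set (q := exp (- H z / 4)) in *.
assert (hq : 0 < q) by apply exp_pos.
assert (hHz : 0 < H z) by (apply hH; unfold Defs.disc; lra).
assert (q3 : exp (- (3 / 4 * H z)) = q ^ 3).
{ simpl; unfold q; rewrite Rmult_1_r, <- !exp_plus; f_equal; field. }
assert (q4 : exp (H z / 2) * q ^ 2 = 1).
{ simpl; unfold q; rewrite Rmult_1_r, <- !exp_plus, <- exp_0; f_equal; field. }
(* [M > e^{H z / 2}] gives more than [e^{H z}] grid points; [M <= 2 e^{H z / 2}] keeps the side
   [M s] of the grid below [64 q]. *)
destruct (exists_nat_above (exp (H z / 2))) as [M [m1 m2]].
{ rewrite <- exp_0; left; apply exp_increasing; lra. }
set (s := 32 * q ^ 3).
assert (hs : 0 < s) by (unfold s; nra).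
assert (M1 : 1 <= INR M).
{ assert (1 < exp (H z / 2)); [| lra].
  rewrite <- exp_0; apply exp_increasing; lra. }
assert (Ms : INR M * s <= 64 * q).
{ unfold s; replace (64 * q) with (2 * exp (H z / 2) * (32 * q ^ 3)).
  - apply Rmult_le_compat_r; [nra | exact m2].
  - transitivity (64 * q * (exp (H z / 2) * q ^ 2)); [ring | rewrite q4; ring]. }
assert (SMs : INR (S M) * s <= 1 / 2) by (rewrite S_INR; nra).
destruct (separated_points x s M hx hs SMs) as [X [X1 X2]].
destruct (separated_points y s M hy hs SMs) as [Y [Y1 Y2]].
(* An index below [M * M] encodes its row and column as quotient and remainder by [M]. *)
pose (rr := fun i => 1 - h * (1 + X (i / M)%nat)).
pose (tt := fun i => 2 * PI * h * (INR j + Y (i mod M)%nat)).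
pose (g := fun i => polar (rr i) (tt i)).
assert (hM0 : (0 < M)%nat) by (apply INR_lt; simpl; lra).
assert (div : forall i, (i < M * M)%nat -> (i / M < M)%nat /\ (i mod M < M)%nat).
{ intros i hi; split;
  [apply Nat.Div0.div_lt_upper_bound; lia | apply Nat.mod_upper_bound; lia]. }
assert (gr : forall i, (i < M * M)%nat -> 1 / 2 <= rr i <= 1 /\ 1 - rr i <= 2 * h).
{ intros i hi; destruct (div i hi) as [d1 _]; destruct (X1 _ d1) as [x1 _]; unfold rr.
  split; [split; nra | nra]. }
(* The displacement is at most [64 q h] in radius and, since [2 PI <= 8], at most [512 q h] along
   the circle; [h <= 1 - Cmod z]. *)
assert (gz : forall i, (i < M * M)%nat ->
  Cmod (g i - z) <= 1024 * q * (1 - Cmod z)).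
{ intros i hi; destruct (div i hi) as [d1 d2].
  destruct (X1 _ d1) as [_ x1]; destruct (Y1 _ d2) as [_ y1].
  rewrite ez; unfold g.
  destruct (gr i hi) as [r1 _].
  eapply Rle_trans; [apply Cmod_polar_sub; lra |].
  unfold rr, tt.
  replace (1 - h * (1 + X (i / M)%nat) - (1 - h * (1 + x)))
    with (h * - (X (i / M)%nat - x)) by ring.
  replace (2 * PI * h * (INR j + Y (i mod M)%nat) - 2 * PI * h * (INR j + y))
    with (2 * PI * h * (Y (i mod M)%nat - y)) by ring.
  rewrite Rabs_mult, Rabs_Ropp, (Rabs_mult (2 * PI * h)).
  rewrite (Rabs_pos_eq h) by lra; rewrite (Rabs_pos_eq (2 * PI * h)) by nra.
  assert (c1 : h * Rabs (X (i / M)%nat - x) <= h * (64 * q))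
    by (apply Rmult_le_compat_l; lra).
  assert (c2 : 2 * PI * h * Rabs (Y (i mod M)%nat - y) <= 8 * h * (64 * q)).
  { apply Rmult_le_compat; [nra | apply Rabs_pos | nra | lra]. }
  rewrite <- ez.
  assert (h * (1024 * q) <= (1 - Cmod z) * (1024 * q)) by (apply Rmult_le_compat_r; lra).
  assert (0 < h * q) by nra; lra. }
assert (gd : forall i, (i < M * M)%nat -> Defs.disc (g i)).
{ intros i hi; unfold Defs.disc.
  replace (g i) with (z + (g i - z))%C by ring.
  eapply Rle_lt_trans; [apply Cmod_triangle |].
  specialize (gz i hi); nra. }
(* Moving by at most [(1 - Cmod z) / 16] with margin [(1 - Cmod z) / 2] costs a factor [exp (1 / 4)]
   in Harnack's inequality, and [exp (- (1 / 4)) >= 3 / 4]. *)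
assert (gH : forall i, (i < M * M)%nat -> exp (- H (g i)) <= q ^ 3).
{ intros i hi; rewrite <- q3.
  specialize (gz i hi); pose proof (Cmod_ge_0 (g i - z)) as p0.
  assert (hk1 := harnack H z (g i) ((1 - Cmod z) / 2) hH).
  assert (hk2 : H z <= exp (1 / 4) * H (g i)).
  { eapply Rle_trans; [apply hk1; nra |].
    apply Rmult_le_compat_r; [left; apply hH; auto |].
    apply exp_monotone.
    apply (Rmult_le_reg_r ((1 - Cmod z) / 2)); [lra |].
    replace (2 * Cmod (g i - z) / ((1 - Cmod z) / 2) * ((1 - Cmod z) / 2))
      with (2 * Cmod (g i - z)) by (field; lra).
    nra. }
  assert (e34 : 3 / 4 <= exp (- (1 / 4))) by (pose proof (exp_ineq1_le (- (1 / 4))); lra).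
  assert (e1 : exp (- (1 / 4)) * exp (1 / 4) = 1)
    by (rewrite <- exp_plus, <- exp_0; f_equal; ring).
  assert (pH : 0 < H (g i)) by (apply hH; auto).
  apply exp_monotone, Ropp_le_contravar.
  pose proof (exp_pos (1 / 4)).
  apply Rle_trans with (exp (- (1 / 4)) * H z); [nra |].
  replace (H (g i)) with (exp (- (1 / 4)) * exp (1 / 4) * H (g i)) by (rewrite e1; ring).
  rewrite Rmult_assoc; apply Rmult_le_compat_l; lra. }
(* Both tolerances are below half the grid spacing, which is [h s] in radius and [2 PI h s] in
   angle, so no zero can serve two grid points. *)
pose (P := fun i n : nat => exists (a : C) (t' : R), L n = Some a /\ a = polar (Cmod a) t' /\
  Rabs (Cmod a - rr i) <= h * s / 4 /\ Rabs (t' - tt i) <= h * s).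
assert (bad : forall i, (i < M * M)%nat -> exists n, P i n).
{ intros i hi.
  assert (nb : ~ forall n a, L n = Some a -> exp (- H (g i)) <= rho (g i) a).
  { intros hb; apply no; exists (g i); auto. }
  apply not_all_ex_not in nb; destruct nb as [n nb].
  apply not_all_ex_not in nb; destruct nb as [a nb].
  apply imply_to_and in nb; destruct nb as [ea nb]; apply Rnot_le_lt in nb.
  destruct (gr i hi) as [r1 r2].
  assert (cl : Cmod (a - g i) <= 8 * h * (q ^ 3)).
  { apply close_of_rho; auto.
    - apply (hL n a ea).
    - unfold g; rewrite Cmod_polar; lra.
    - split; nra.
    - specialize (gH i hi); lra. }
  replace (8 * h * q ^ 3) with (h * s / 4) in cl by (unfold s; field).
  destruct (polar_near (rr i) (tt i) (h * s / 4) a) as [t' [p1 [p2 p3]]]; auto.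
  - lra.
  - nra.
  - exists n, a, t'; split; [exact ea | split; [exact p1 | split; [exact p2 | lra]]]. }
(* The margin [s] of [Y] is worth [2 PI h s] in angle, more than the tolerance [h s]. *)
assert (Ycell : forall i t', (i < M * M)%nat -> Rabs (t' - tt i) <= h * s ->
  exists y', 0 <= y' < 1 /\ t' = 2 * PI * h * (INR j + y')).
{ intros i t' hi ht; destruct (div i hi) as [_ d2]; destruct (Y1 _ d2) as [y1 _].
  apply Rabs_le_between in ht; unfold tt in ht.
  assert (hp : 0 < 2 * PI * h) by nra.
  exists (t' / (2 * PI * h) - INR j); split; [| field; lra].
  set (y' := t' / (2 * PI * h) - INR j).
  assert (et : t' = 2 * PI * h * (INR j + y')) by (unfold y'; field; lra).
  rewrite et in ht; clearbody y'.
  assert (hsm : h * s < 2 * PI * h * s).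
  { assert (0 < h * s) by nra; nra. }
  split.
  - apply Rnot_lt_le; intros c.
    assert (2 * PI * h * (Y (i mod M)%nat - y') > 2 * PI * h * s) by
      (apply Rmult_gt_compat_l; lra); lra.
  - apply Rnot_le_lt; intros c.
    assert (2 * PI * h * (y' - Y (i mod M)%nat) >= 2 * PI * h * s) by
      (apply Rmult_ge_compat_l; lra); lra. }
destruct (injective_choice_list P (M * M) bad) as [l [nd [len hl]]].
{ intros i i' n hi hi' [a [t1 [ea [pa [ra ta]]]]] [a' [t2 [ea' [pa' [ra' ta']]]]].
  rewrite ea in ea'; injection ea'; intros <-.
  destruct (div i hi) as [d1 d2]; destruct (div i' hi') as [d1' d2'].
  destruct (gr i hi) as [r1 _].
  apply Rabs_le_between in ra; apply Rabs_le_between in ra'.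
  assert (hsp : 0 < h * s) by nra.
  assert (E1 : (i / M = i' / M)%nat).
  { apply NNPP; intros ne; specialize (X2 _ _ ne).
    assert (u : Rabs (h * (X (i / M)%nat - X (i' / M)%nat)) <= h * s / 2).
    { apply Rabs_le; unfold rr in ra, ra'; lra. }
    rewrite Rabs_mult, (Rabs_pos_eq h) in u by lra.
    assert (h * s <= h * Rabs (X (i / M)%nat - X (i' / M)%nat))
      by (apply Rmult_le_compat_l; lra); lra. }
  (* The two angles found for the same zero lie in one cell, an interval of length
     [2 PI h <= PI / 2], and hence coincide; grid angles [2 PI h s] apart cannot both be within
     [h s] of it. *)
  assert (E2 : (i mod M = i' mod M)%nat).
  { apply NNPP; intros ne; specialize (Y2 _ _ ne).
    destruct (Ycell i t1 hi ta) as [w1 [b1 e1]].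
    destruct (Ycell i' t2 hi' ta') as [w2 [b2 e2]].
    assert (t12 : t1 = t2).
    { apply (polar_inj (Cmod a)).
      - nra.
      - rewrite e1, e2.
        replace (2 * PI * h * (INR j + w1) - 2 * PI * h * (INR j + w2))
          with (2 * PI * h * (w1 - w2)) by ring.
        assert (2 * PI * h <= PI / 2) by nra.
        apply Rabs_def1; nra.
      - rewrite <- pa; exact pa'. }
    subst t2.
    apply Rabs_le_between in ta; apply Rabs_le_between in ta'.
    assert (u : Rabs (2 * PI * h * (Y (i mod M)%nat - Y (i' mod M)%nat)) <= 2 * (h * s)).
    { apply Rabs_le; unfold tt in ta, ta'; lra. }
    rewrite Rabs_mult, (Rabs_pos_eq (2 * PI * h)) in u by nra.
    assert (2 * PI * h * s <= 2 * PI * h * Rabs (Y (i mod M)%nat - Y (i' mod M)%nat))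
      by (apply Rmult_le_compat_l; nra).
    assert (3 * (h * s) < PI * (h * s)) by (apply Rmult_lt_compat_r; lra); lra. }
  rewrite (Nat.div_mod_eq i M), (Nat.div_mod_eq i' M), E1, E2; reflexivity. }
assert (cnt : INR (length l) <= exp (H z)).
{ apply (count_in_whitney L H k j z l (hN k j hj)); auto.
  - rewrite ez; apply whitney_polar; auto; fold h; lra.
  - intros n hin; destruct (hl n hin) as [i [hi [a [t' [ea [pa [ra ta]]]]]]].
    exists a; split; [exact ea |].
    destruct (Ycell i t' hi ta) as [y' [b' e']].
    destruct (div i hi) as [d1 _]; destruct (X1 _ d1) as [x1 _].
    apply Rabs_le_between in ra; unfold rr in ra.
    assert (hsp : 0 < h * s) by nra.
    rewrite pa, e'.
    replace (Cmod a) with (1 - h * (1 + ((1 - Cmod a) / h - 1))) by (field; lra).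
    apply whitney_polar; auto; [| fold h; lra].
    set (x' := (1 - Cmod a) / h - 1).
    assert (ex : Cmod a = 1 - h * (1 + x')) by (unfold x'; field; lra).
    rewrite ex in ra; clearbody x'.
    split; [apply Rnot_lt_le | apply Rnot_le_lt]; intros c; nra. }
rewrite len, mult_INR in cnt.
assert (e2 : exp (H z) = exp (H z / 2) * exp (H z / 2)).
{ rewrite <- exp_plus; f_equal; field. }
pose proof (exp_pos (H z / 2)); nra.
Qed.

(** * Comparison at a nearby point *)

(** With [D = |1 - Cconj a * z| >= 1 - |z|], the move to [z'] adds at most [e D] to the numerator
    and takes at most half of the denominator. *)
Lemma rho_perturb (z z' a : C) (e : R) :
  Defs.disc a -> Defs.disc z -> Defs.disc z' -> 0 <= e <= 1 / 2 ->
  Cmod (z' - z) <= e * (1 - Cmod z) -> rho z' a <= 2 * (rho z a + e).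
Proof.
intros ha hz hz' he h; rewrite !rho_eq by assumption.
destruct (Cmod_disc_sub_ge a z ha hz) as [d _].
set (D := Cmod (1 - Cconj a * z)) in *.
unfold Defs.disc in hz, ha; pose proof (Cmod_ge_0 a).
assert (hD : Cmod (z' - z) <= e * D) by nra.
assert (n1 : Cmod (z' - a) <= Cmod (z - a) + e * D).
{ replace (z' - a)%C with ((z - a) + (z' - z))%C by ring.
  apply Cmod_plus_le; lra. }
assert (n2 : D * (1 - e) <= Cmod (1 - Cconj a * z')).
{ assert (t := Cmod_triangle (1 - Cconj a * z') (Cconj a * (z' - z))).
  replace (1 - Cconj a * z' + Cconj a * (z' - z))%C with (1 - Cconj a * z)%C in t by ring.
  fold D in t; rewrite Cmod_mult, Cmod_conj in t.
  pose proof (Cmod_ge_0 (z' - z)); nra. }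
assert (pD : 0 < D) by lra.
assert (n3 : D / 2 <= Cmod (1 - Cconj a * z')) by nra.
apply (Rmult_le_reg_r (Cmod (1 - Cconj a * z'))); [lra |].
replace (Cmod (z' - a) / Cmod (1 - Cconj a * z') * Cmod (1 - Cconj a * z'))
  with (Cmod (z' - a)) by (field; lra).
pose proof (Cmod_ge_0 (z - a)) as p1.
assert (p2 : 0 <= Cmod (z - a) / D).
{ unfold Rdiv; apply Rmult_le_pos; [exact p1 |]; left; apply Rinv_0_lt_compat; exact pD. }
apply Rle_trans with (2 * (Cmod (z - a) / D + e) * (D / 2)).
- replace (2 * (Cmod (z - a) / D + e) * (D / 2)) with (Cmod (z - a) + e * D)
    by (field; lra); exact n1.
- apply Rmult_le_compat_l; lra.
Qed.

(* For [x >= 1/16] the last term suffices; for [e <= x < 1/16] one has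
   [y ^ 2 <= 16 x ^ 2 <= x]; and for [x < e] the two logarithms are at most
   [c t] and at least [t / 8] in absolute value. *)
Lemma neg_ln_compare (x y e c t : R) :
  1 < c -> 0 < t -> 4 * e <= exp (- t / 8) -> exp (- c * t) <= x <= 1 ->
  0 < y <= 1 -> y <= 2 * (x + e) ->
  - ln x <= 8 * c * - ln y + 16 * (1 - x ^ 2).
Proof.
intros hc ht he hx hy hxy.
pose proof (exp_pos (- c * t)) as xp.
assert (ly : 0 <= - ln y).
{ assert (ln y <= 0) by (rewrite <- ln_1; apply ln_le; lra); lra. }
assert (x2 : 0 <= 1 - x ^ 2) by nra.
assert (cly : - ln y <= c * - ln y) by nra.
destruct (Rle_dec (1 / 16) x) as [h1 | h1].
- pose proof (neg_ln_le x (1 / 16) ltac:(lra) ltac:(lra)) as h.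
  replace (/ (1 / 16)) with 16 in h by field; nra.
- destruct (Rle_dec e x) as [h2 | h2].
  + assert (l2 : ln (y * y) <= ln x) by (apply ln_le; nra).
    rewrite ln_mult in l2 by lra; nra.
  + assert (l1 : - c * t <= ln x) by (rewrite <- (ln_exp (- c * t)); apply ln_le; lra).
    assert (l2 : ln y <= - t / 8).
    { rewrite <- (ln_exp (- t / 8)); apply ln_le; lra. }
    assert (c * (t / 8) <= c * - ln y) by (apply Rmult_le_compat_l; lra).
    nra.
Qed.

(** The passage goes through the midpoint [m], because [harnack] needs [|z| + |z' - z| < 1], which
    fails for [|z| = 1 / 2] and [z' = 0]. Each half costs [exp 4]. *)
Lemma harnack_origin (H : C -> R) (z : C) :
  Har_plus H -> Cmod z <= 1 / 2 -> H z <= exp 8 * H 0.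
Proof.
intros hH hz; pose proof (Cmod_ge_0 z) as p.
set (m := (RtoC (1 / 2) * z)%C).
assert (cm : Cmod m = Cmod z / 2).
{ unfold m; rewrite Cmod_mult, Cmod_R, Rabs_pos_eq; lra. }
assert (d1 : Cmod (m - z) = Cmod z / 2).
{ rewrite <- cm, <- Cmod_opp; f_equal; unfold m.
  destruct z as [x y]; unfold Cminus, Cplus, Copp, Cmult, RtoC; simpl; f_equal; field. }
assert (d2 : Cmod (0 - m) = Cmod z / 2).
{ rewrite <- cm, <- (Cmod_opp m); f_equal; ring. }
assert (pos : forall y, Cmod y < 1 -> 0 <= H y) by (intros y hy; left; apply hH; exact hy).
assert (a1 := harnack H z m (1 / 8) hH ltac:(lra) ltac:(lra)).
assert (a2 := harnack H m 0 (1 / 8) hH ltac:(lra) ltac:(lra)).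
rewrite d1 in a1; rewrite d2 in a2.
assert (e4 : exp (2 * (Cmod z / 2) / (1 / 8)) <= exp 4) by (apply exp_monotone; lra).
assert (p1 := pos m ltac:(lra)).
assert (p2 := pos 0 ltac:(rewrite Cmod_0; lra)).
replace 8 with (4 + 4) by ring; rewrite exp_plus, Rmult_assoc.
pose proof (exp_pos 4).
apply Rle_trans with (exp 4 * H m).
- eapply Rle_trans; [exact a1 |]; apply Rmult_le_compat_r; assumption.
- apply Rmult_le_compat_l; [lra |].
  eapply Rle_trans; [exact a2 |]; apply Rmult_le_compat_r; assumption.
Qed.

Theorem theorem4 (L : zero_seq) (B : C -> C) (H : C -> R)
    (hB : is_blaschke_product L B)
    (hH : Har_plus H)
    (hN : forall k j : nat, (j < 2 ^ k)%nat ->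
      Rbar_le (count_in L (whitney k j))
              (inf_on (whitney k j) (fun z => exp (H z))))
    (hmaj : has_harmonic_majorant (neg_log_mod B) (far_from L H)) :
  forall c : R, 1 < c ->
    has_harmonic_majorant (neg_log_mod B) (far_from L (fun z => c * H z)).
Proof.
intros c hc.
destruct hmaj as [H1 [hH1 maj]].
pose proof hB as [hL [sL _]].
assert (hU := Har_plus_zero_majorant L hL sL).
(* Above [8 ln 4096] one has [4 * 1024 * exp (- H z / 4) <= exp (- H z / 8)]; above [exp 8 * H 0]
   the point [z] satisfies [|z| > 1 / 2]. *)
pose (T := Rmax (8 * ln 4096) (exp 8 * H 0)).
pose proof (exp_pos (c * T)) as eT.
(* [16 * c] is [8 * c] from the comparison of logarithms times 2 from Harnack's inequality for [H1].
   The 16 comes from [neg_ln_compare], and [exp (c * T)] covers the points with [H z <= T]. *)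
exists (fun z => (16 * c) * H1 z + (16 + exp (c * T)) * zero_majorant L z).
split; [apply Har_plus_lincomb; auto; lra |].
intros z hz; apply far_from_iff in hz; destruct hz as [dz far].
assert (pH : 0 < H z) by (apply hH; exact dz).
assert (pH1 : 0 < H1 z) by (apply hH1; exact dz).
assert (pU : 0 < zero_majorant L z) by (apply hU; exact dz).
assert (dist : forall n, exp (- (c * H z)) <= zero_dist L z n).
{ intros n; unfold zero_dist; destruct (L n) as [a |] eqn:e; [apply (far n a e) |].
  rewrite <- exp_0; apply exp_monotone; nra. }
destruct (Rle_dec (H z) T) as [hT | hT].
- destruct (neg_log_mod_away L B z (exp (- (c * T)))) as [_ h]; auto.
  + apply exp_pos.
  + intros n; eapply Rle_trans; [| apply dist].
    apply exp_monotone; nra.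
  + rewrite exp_Ropp, Rinv_inv in h; nra.
- apply Rnot_le_lt in hT.
  assert (T1 : 8 * ln 4096 < H z)
    by (apply Rle_lt_trans with T; [apply Rmax_l | exact hT]).
  assert (T2 : exp 8 * H 0 < H z)
    by (apply Rle_lt_trans with T; [apply Rmax_r | exact hT]).
  assert (big : 1 / 2 < Cmod z < 1).
  { split; [| exact dz]; apply Rnot_le_lt; intros hz.
    pose proof (harnack_origin H z hH hz); lra. }
  set (e := 1024 * exp (- H z / 4)).
  assert (he : 4 * e <= exp (- H z / 8) /\ exp (- H z / 8) <= / 4096 /\ 0 < e).
  { assert (f : exp (- H z / 8) <= / 4096).
    { rewrite <- (exp_ln 4096), <- exp_Ropp by lra; apply exp_monotone; lra. }
    assert (g : exp (- H z / 4) = exp (- H z / 8) * exp (- H z / 8))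
      by (rewrite <- exp_plus; f_equal; field).
    pose proof (exp_pos (- H z / 8)) as p; unfold e; rewrite g.
    split; [nra | split; [exact f | nra]]. }
  destruct (exists_good_point L H z hL hH hN big) as [z' [dz' [near good]]].
  { fold e; lra. }
  fold e in near.
  assert (far' : far_from L H z') by (apply far_from_iff; auto).
  assert (m := maj z' far').
  assert (pH' : 0 < H z') by (apply hH; exact dz').
  assert (dist' : forall n, exp (- H z') <= zero_dist L z' n).
  { intros n; unfold zero_dist; destruct (L n) as [a |] eqn:ea; [apply (good n a ea) |].
    rewrite <- exp_0; apply exp_monotone; lra. }
  assert (h : neg_log_mod B z <= 8 * c * neg_log_mod B z' + 16 * zero_majorant L z).
  { apply (neg_log_mod_compare L B z z' (8 * c) 16 (exp (- (c * H z))) (exp (- H z')));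
      auto using exp_pos; [lra |].
    intros n; apply (neg_ln_compare _ _ e c (H z)); auto; try lra.
    - replace (- c * H z) with (- (c * H z)) by ring.
      split; [apply dist |]; unfold zero_dist; destruct (L n) as [a |] eqn:ea; [| lra].
      apply rho_le_1; eauto.
    - pose proof (exp_pos (- H z')); split; [specialize (dist' n); lra |].
      unfold zero_dist; destruct (L n) as [a |] eqn:ea; [| lra].
      apply rho_le_1; eauto.
    - unfold zero_dist; destruct (L n) as [a |] eqn:ea; [| lra].
      apply rho_perturb; eauto; lra. }
  (* Harnack's inequality is started at [z'], with margin [(1 - Cmod z) / 2]; the short distance
     makes its factor at most [exp (1 / 2)], which is below 2. *)
  assert (k : H1 z' <= 2 * H1 z).
  { assert (s : Cmod (z - z') = Cmod (z' - z)) by (rewrite <- Cmod_opp; f_equal; ring).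
    assert (t : Cmod z' <= Cmod z + Cmod (z' - z)).
    { replace z' with (z + (z' - z))%C at 1 by ring; apply Cmod_triangle. }
    eapply Rle_trans; [apply (harnack H1 z' z ((1 - Cmod z) / 2) hH1); rewrite ?s; nra |].
    rewrite s; apply Rmult_le_compat_r; [lra |].
    apply Rle_trans with (exp (1 / 2)).
    - apply exp_monotone; apply (Rmult_le_reg_r ((1 - Cmod z) / 2)); [lra |].
      replace (2 * Cmod (z' - z) / ((1 - Cmod z) / 2) * ((1 - Cmod z) / 2))
        with (2 * Cmod (z' - z)) by (field; lra).
      nra.
    - pose proof (exp_ineq1_le (- (1 / 2))) as q.
      assert (r : exp (1 / 2) * exp (- (1 / 2)) = 1)
        by (rewrite <- exp_plus, <- exp_0; f_equal; ring).
      pose proof (exp_pos (1 / 2)); nra. }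
  assert (8 * c * neg_log_mod B z' <= 8 * c * (2 * H1 z)) by (apply Rmult_le_compat_l; lra).
  nra.
Qed.
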